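(* Let $G$ be a locally compact Polish group and $X$ be a locally compact Polish space with $(\operatorname{card}(G),\operatorname{card}(X)) \neq (1,2)$. Let $G \times X \ni (g,x) \mapsto g.x \in X$ be a continuous proper non-transitive action of $G$ on $X$ such that for some point $\omega \in X$: (F1) $G$ acts freely at $\omega$, i.e. for $g \in G$, $g.\omega = \omega$ implies $g = e_G$; (F2) $G$ acts effectively on $X \setminus G.\omega$, i.e. if $g \in G$ satisfies $g.x = x$ for every $x \in X \setminus G.\omega$, then $g = e_G$. Then there exists $d \in \operatorname{Metr}_c(X)$ such that $\operatorname{Iso}(X,d)$ consists precisely of all maps of the form $x \mapsto a.x$ $(a \in G)$.
   Context: A topological space or group is Polish if it is separable and completely metrizable. A metric is proper if all closed balls with respect to it are compact. For a locally compact Polish space $X$, $\operatorname{Metr}_c(X)$ is the set of all proper metrics on $X$ which induce the topology of $X$. $\operatorname{Iso}(X,d)$ is the group of all bijective isometries of $(X,d)$. $e_G$ is the neutral element of $G$ and $G.\omega = \{g.\omega : g \in G\}$. An action is transitive if $G.x = X$ for some $x \in X$. An action is proper if the map $G \times X \ni (g,x) \mapsto (x,g.x) \in X \times X$ is proper, i.e. preimages of compact sets are compact (equivalently, for every compact $K \subset X$ the set $\{g \in G : g.K \cap K \neq \varnothing\}$ is compact). *)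

(* Defs.v *)
From HB Require Import structures.
From mathcomp Require Import all_boot all_order all_algebra.
From mathcomp Require Import all_classical all_reals all_analysis.
Set Implicit Arguments.
Unset Strict Implicit.
Unset Printing Implicit Defensive.
Import Order.TTheory GRing.Theory Num.Theory.
Import numFieldNormedType.Exports.
Local Open Scope classical_set_scope.
Local Open Scope ring_scope.

HB.mixin Record isTopologicalGroup G & Topological G & Group G := {
  mulg_continuous : continuous (fun p : G * G => (p.1 * p.2)%g) ;
  invg_continuous : continuous (fun x : G => (x^-1)%g)
}.

#[short(type="topologicalGroupType")]
HB.structure Definition TopologicalGroup :=
  {G of Topological G & Group G & isTopologicalGroup G}.

(* Metrics are plain functions rather than the library's [metricType], because
   one fixed topological space is considered with several metrics.  As in
   [isMetric], nonnegativity follows from the other axioms. *)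
Record is_metric (R : realType) (T : Type) (d : T -> T -> R) : Prop := {
  metric_refl : forall x, d x x = 0 ;
  metric_positivity : forall x y, d x y = 0 -> x = y ;
  metric_symmetric : forall x y, d x y = d y x ;
  metric_triangular : forall x y z, d x z <= d x y + d y z
}.

Definition induces_topology (R : realType) (T : topologicalType)
    (d : T -> T -> R) : Prop :=
  forall x, nbhs x = nbhs_ball_ (fun y (e : R) => [set z | d y z < e]) x.

Definition complete_metric (R : realType) (T : Type) (d : T -> T -> R) : Prop :=
  forall u : nat -> T,
    (forall e : R, 0 < e -> \forall m \near \oo & n \near \oo, d (u m) (u n) < e) ->
    exists l, forall e : R, 0 < e -> \forall n \near \oo, d (u n) l < e.

Definition separable_space (T : topologicalType) : Prop :=
  exists2 D : set T, countable D & dense D.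

Definition completely_metrizable (R : realType) (T : topologicalType) : Prop :=
  exists d : T -> T -> R,
    [/\ is_metric d, induces_topology d & complete_metric d].

Definition polish (R : realType) (T : topologicalType) : Prop :=
  separable_space T /\ completely_metrizable R T.

Definition proper_metric (R : realType) (T : topologicalType)
    (d : T -> T -> R) : Prop :=
  forall x r, compact [set y | d x y <= r].

Definition Metr_c (R : realType) (X : topologicalType) : set (X -> X -> R) :=
  [set d | [/\ is_metric d, induces_topology d & proper_metric d]].

Definition Iso (R : realType) (X : Type) (d : X -> X -> R) : set (X -> X) :=
  [set f | bijective f /\ forall x y, d (f x) (f y) = d x y].

Definition is_action (G : groupType) (X : Type) (act : G -> X -> X) : Prop :=
  (forall x, act 1%g x = x) /\
  (forall g h x, act (g * h)%g x = act g (act h x)).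

Definition continuous_action (G : topologicalGroupType) (X : topologicalType)
    (act : G -> X -> X) : Prop :=
  continuous (fun p : G * X => act p.1 p.2).

Definition proper_map (U V : topologicalType) (f : U -> V) : Prop :=
  forall K : set V, compact K -> compact (f @^-1` K).

Definition proper_action (G : topologicalGroupType) (X : topologicalType)
    (act : G -> X -> X) : Prop :=
  proper_map (fun p : G * X => (p.2, act p.1 p.2)).

Definition orbit_of (G : groupType) (X : Type) (act : G -> X -> X) (x : X) :
    set X :=
  [set act g x | g in [set: G]].

Definition transitive_action (G : groupType) (X : Type)
    (act : G -> X -> X) : Prop :=
  exists x, orbit_of act x = [set: X].

Definition free_at (G : groupType) (X : Type) (act : G -> X -> X)
    (x : X) : Prop :=
  forall g, act g x = x -> g = 1%g.

Definition effective_on (G : groupType) (X : Type) (act : G -> X -> X)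
    (A : set X) : Prop :=
  forall g, (forall x, A x -> act g x = x) -> g = 1%g.

(* Main.v *)
Require Import Defs.
From mathcomp Require Import all_boot all_order all_algebra.
From mathcomp Require Import all_classical all_reals all_analysis.
From mathcomp Require Import lra.
Local Open Scope classical_set_scope.
Local Open Scope card_scope.

(** Two pairs of points are in the same class when an element of G maps one to
    the other, possibly after exchanging the two points of one of them.  The
    metric constructed below is invariant and has the property that each of its
    isometries f keeps every pair (x, y) with x <> y in its class
    ([pair_class_metric]).  Such an f comes from G ([pair_symmetry_in_group]).
    Indeed the classes of (w, x) and (w, z), for x outside the orbit of w and
    z <> w outside the orbit of x, force f w into the orbit of w, so f may be
    assumed to fix w; since only the identity fixes w, the class of (w, y)
    forces f y = y for y outside the orbit of w; and at a point g.w the classes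
    of all pairs (g.w, y) force f (g.w) = h.g.w for one h that fixes every such
    y, so that h = 1.  The excluded cardinalities are those for which there is
    no z ([second_pair_point]).

    The construction starts from an invariant proper metric rho
    ([invariant_proper_metric]).  Suprema over G of compactly supported bump
    functions give an invariant metric for the topology, properness of the
    action making these suprema continuous.  It is made proper by passing to
    chains, in which a short step is measured relative to the radius of
    relatively compact balls and a long step, which may be taken between any
    two points, costs at least 1 and a bounded cost leads from a compact set
    only into a relatively compact one.

    Let d be the square root of rho.  Its triangle inequality has enough slack
    to add to d any nonnegative symmetric function of two variables that
    vanishes on the diagonal and has a small Lipschitz constant
    ([perturbed_Metr_c]).  A function that is Lipschitz for rho has local
    Lipschitz constant 0 for d; so has d itself, as a function on pairs, off the
    diagonal, and so has the square root of the rho-distance to a class, except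
    on the class itself, where the constant is between 1/2 and 1 unless the
    class is open.  Adding truncations of such functions for a dense sequence of
    classes that are not open, with coefficients 8^-(n+1), puts on each of these
    classes a label, the order of magnitude of its local Lipschitz constant,
    which an isometry of the new metric has to respect.
    Open classes are labelled by the value of the metric instead, which is
    constant on each of them and can be adjusted to separate them.  Classes are
    closed, so respecting a dense set of labels means respecting all
    classes. *)

Section Preliminaries.
Set Implicit Arguments.
Unset Strict Implicit.
Import Order.TTheory GRing.Theory Num.Theory numFieldNormedType.Exports.
Local Open Scope ring_scope.

(** * Relatively compact sets and tame relations *)

Section Compactness.

Definition relcompact (T : topologicalType) (A : set T) :=
  exists2 K, compact K & A `<=` K.

Lemma relcompactS (T : topologicalType) (A B : set T) :
  A `<=` B -> relcompact B -> relcompact A.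
Proof. by move=> AB [K cK BK]; exists K => // x /AB /BK. Qed.

Lemma relcompactU (T : topologicalType) (A B : set T) :
  relcompact A -> relcompact B -> relcompact (A `|` B).
Proof.
move=> [K cK AK] [L cL BL]; exists (K `|` L); first exact: compactU.
by move=> x [/AK|/BL]; [left|right].
Qed.

Lemma relcompact0 (T : topologicalType) : relcompact (@set0 T).
Proof. by exists set0; first exact: compact0. Qed.

(** The sets [A] such that [P] holds of [K] minus [A] form a filter that no point
    of [K] can be a cluster point of. *)
Lemma compact_induction (T : topologicalType) (P : set T -> Prop) (K : set T) :
  compact K -> P set0 -> (forall A B, A `<=` B -> P B -> P A) ->
  (forall A B, P A -> P B -> P (A `|` B)) ->
  (forall x, K x -> exists2 U, nbhs x U & P U) -> P K.
Proof.
move=> cK P0 PS PU PK; apply: contrapT => nPK.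
pose F : set_system T := [set A | P (K `&` ~` A)].
have FF : ProperFilter F.
  split; first by rewrite /F /= setC0 setIT.
  split.
  - by rewrite /F /= setCT setI0.
  - by move=> A B PA PB; rewrite /F /= setCI setIUr; exact: PU.
  - by move=> A B AB; apply: PS; apply: setIS; apply: subsetC.
have FK : F K by rewrite /F /= setICr.
have [x [Kx clx]] := cK F FF FK.
have [U nU PUx] := PK x Kx.
have FU : F (~` U) by apply: PS PUx; rewrite setCK => y [].
by have [y []] := clx _ _ FU nU.
Qed.

Lemma relcompact_closed (T : topologicalType) (A : set T) :
  closed A -> relcompact A -> compact A.
Proof. by move=> cA [K cK AK]; exact: subclosed_compact cK AK. Qed.

(** [E x] is the set of points reachable from [x].  For [E x] the ball of a fixed
    radius this is a uniform form of properness, and unlike properness of a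
    metric it survives composition of relations. *)
Definition tame (T : topologicalType) (E : T -> set T) :=
  forall K, compact K -> relcompact (\bigcup_(x in K) E x).

Lemma tame_relcompact (T : topologicalType) (E : T -> set T) (A : set T) :
  tame E -> relcompact A -> relcompact (\bigcup_(x in A) E x).
Proof.
move=> tE [K cK AK]; apply: relcompactS (tE K cK).
exact: bigcup_subset.
Qed.

Lemma tame_local (T : topologicalType) (E : T -> set T) :
  (forall x : T, exists2 U, nbhs x U & relcompact (\bigcup_(y in U) E y)) ->
  tame E.
Proof.
move=> locE K cK.
apply: (@compact_induction _ (fun A => relcompact (\bigcup_(x in A) E x)) K) => //.
- by rewrite bigcup_set0; exact: relcompact0.
- by move=> A B AB; apply: relcompactS; exact: bigcup_subset.
- by move=> A B ? ?; rewrite bigcup_setU; exact: relcompactU.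
Qed.

Lemma tameS (T : topologicalType) (E F : T -> set T) :
  (forall x, E x `<=` F x) -> tame F -> tame E.
Proof.
move=> EF tF K cK; apply: relcompactS (tF K cK) => y [x Kx Exy].
by exists x => //; exact: EF.
Qed.

Lemma tameU (T : topologicalType) (E F : T -> set T) : tame E -> tame F ->
  tame (fun x => E x `|` F x).
Proof.
move=> tE tF K cK; apply: relcompactS (relcompactU (tE K cK) (tF K cK)).
by move=> y [x Kx [Exy|Fxy]]; [left|right]; exists x.
Qed.

Lemma tame_comp (T : topologicalType) (E F : T -> set T) : tame E -> tame F ->
  tame (fun x => \bigcup_(y in E x) F y).
Proof.
move=> tE tF K cK; apply: relcompactS (tame_relcompact tF (tE K cK)).
by move=> z [x Kx [y Exy Fyz]]; exists y => //; exists x.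
Qed.

End Compactness.

(** * Metrics that induce a given topology *)

Section MetricTopology.
Variables (R : realType) (X : topologicalType) (d : X -> X -> R).
Hypotheses (dm : is_metric d).

Lemma metric_ge0 x y : 0 <= d x y.
Proof.
have := metric_triangular dm x y x.
rewrite (metric_refl dm) (metric_symmetric dm y x); lra.
Qed.

Lemma metric_distB x y z : `|d z x - d z y| <= d x y.
Proof.
have h1 := metric_triangular dm z x y; have h2 := metric_triangular dm z y x.
rewrite (metric_symmetric dm y x) in h2.
by rewrite ler_norml; apply/andP; split; lra.
Qed.

Lemma induces_topologyP :
  (forall x (U : set X), nbhs x U <-> exists2 e : R, 0 < e & forall y, d x y < e -> U y)
  <-> induces_topology d.
Proof.
split=> [H x|H x U]; last by rewrite H.
by apply/funext => U; apply/propext; rewrite H.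
Qed.

Hypothesis dt : induces_topology d.

Lemma nbhs_metricP x (U : set X) :
  nbhs x U <-> exists2 e : R, 0 < e & forall y, d x y < e -> U y.
Proof. exact: (iffRL induces_topologyP). Qed.

Lemma nbhs_metric_ball x e : 0 < e -> nbhs x [set y | d x y < e].
Proof. by move=> e0; apply/nbhs_metricP; exists e. Qed.

Lemma lipschitz_metric_continuous (f : X -> R) :
  (forall x y, `|f x - f y| <= d x y) -> continuous f.
Proof.
move=> fl x; apply/cvgrPdist_lt => e e0.
by apply: filterS (nbhs_metric_ball x e0) => y /=; exact: le_lt_trans.
Qed.

Lemma metric_continuous x : continuous (d x).
Proof. by apply: lipschitz_metric_continuous => y z; exact: metric_distB. Qed.

Lemma inducing_metric_T2 : hausdorff_space X.
Proof.
move=> p q clpq; apply: (metric_positivity dm); apply/eqP.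
rewrite eq_le metric_ge0 andbT leNgt; apply/negP => e0.
have e2 : 0 < d p q / 2 by lra.
have [z [/= hp hq]] := clpq _ _ (nbhs_metric_ball p e2) (nbhs_metric_ball q e2).
have := metric_triangular dm p z q; rewrite (metric_symmetric dm z q); lra.
Qed.

Lemma metric_closed_ball_compact x r :
  relcompact [set y | d x y <= r] -> compact [set y | d x y <= r].
Proof.
apply: relcompact_closed.
rewrite (_ : [set y | _] = d x @^-1` [set t | t <= r]) //.
apply: closed_comp; last exact: closed_le.
by move=> y _; exact: metric_continuous.
Qed.

End MetricTopology.

(** * Proper actions *)

Section ActionBasics.
Variables (G : topologicalGroupType) (X : topologicalType) (act : G -> X -> X).
Hypothesis act_action : is_action act.

Lemma actK g x : act g^-1%g (act g x) = x.
Proof. by rewrite -(proj2 act_action) mulVg (proj1 act_action). Qed.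

Lemma actKV g x : act g (act g^-1%g x) = x.
Proof. by rewrite -(proj2 act_action) mulgV (proj1 act_action). Qed.

Hypothesis act_continuous : continuous_action act.

Lemma act_cvg (T : Type) (F : set_system T) (FF : Filter F) (a : T -> G)
    (f : T -> X) g x :
  a @ F --> g -> f @ F --> x -> (fun t => act (a t) (f t)) @ F --> act g x.
Proof.
move=> ag fx; apply: (@continuous2_cvg _ _ _ _ _ _ a f act) => //.
exact: (@act_continuous (g, x)).
Qed.

Lemma act_continuousr g : continuous (act g).
Proof. by move=> x; apply: act_cvg; [exact: cvg_cst|exact: cvg_id]. Qed.

Hypothesis act_proper : proper_action act.

(** This compact set is the projection to [G] of the preimage of [K `*` L] under
    the proper map of the action. *)
Lemma transporter_compact (K L : set X) : compact K -> compact L ->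
  compact [set g | exists2 x, K x & L (act g x)].
Proof.
move=> cK cL; have cKL := act_proper (compact_setX cK cL).
have : compact [set p.1 | p in (fun p : G * X => (p.2, act p.1 p.2)) @^-1` (K `*` L)].
  apply: continuous_compact => //; apply: continuous_subspaceT => p.
  exact: cvg_fst.
congr compact; apply/seteqP; split => g /=.
- by move=> [[h x] /= [Kx Lx] <-]; exists x.
- by move=> [x Kx Lx]; exists (g, x).
Qed.

(** From [x] one reaches [act g^-1 z] with [z] in [L] and [g] moving [x] into [L]; for
    [x] in a compact set such [g] form a compact set. *)
Lemma saturation_tame (L : set X) : compact L ->
  tame (fun x => [set y | exists g, L (act g x) /\ L (act g y)]).
Proof.
move=> cL K cK.
set C := [set g | exists2 x, K x & L (act g x)].
have cC : compact C by exact: transporter_compact.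
exists [set act p.1^-1%g p.2 | p in C `*` L].
  apply: continuous_compact; last exact: compact_setX.
  apply: continuous_subspaceT => p.
  apply: act_cvg; last exact: cvg_snd.
  by apply: continuous_cvg; [exact: invg_continuous|exact: cvg_fst].
move=> y [x Kx [g [Lx Ly]]]; exists (g, act g y); last exact: actK.
by split => //=; exists x.
Qed.

End ActionBasics.

(** * An invariant compatible metric *)

Section Suprema.
Variables (R : realType) (J : Type) (j0 : J) (f : J -> R) (M : R).
Hypothesis fM : forall j, f j <= M.

Let has_sup_range : has_sup (range f).
Proof.
by split; [exists (f j0), j0|exists M => _ [j _ <-]].
Qed.

Lemma le_sup_range j : f j <= sup (range f).
Proof. by apply: (ub_le_sup (proj2 has_sup_range)); exists j. Qed.

Lemma sup_range_le : sup (range f) <= M.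
Proof. by apply: ge_sup (proj1 has_sup_range) _ => _ [j _ <-]. Qed.

Lemma lt_sup_range v : v < sup (range f) -> exists j, v < f j.
Proof.
move=> v_lt; have e0 : 0 < sup (range f) - v by rewrite subr_gt0.
have [_ [j _ <-]] := sup_adherent e0 has_sup_range.
by rewrite subKr => ?; exists j.
Qed.

End Suprema.

Section Bumps.
Variables (R : realType) (X : topologicalType).

(** A cone of height [s]: it localises a distance [t] to the ball of radius [s]. *)
Definition cap (s t : R) : R := Num.max 0 (s - t).

Lemma cap_ge0 s t : 0 <= cap s t.
Proof. by rewrite le_max lexx. Qed.

Lemma cap_le s t : 0 <= s -> 0 <= t -> cap s t <= s.
Proof. by move=> s0 t0; rewrite ge_max s0 /=; lra. Qed.

Lemma cap_gt0 s t : (0 < cap s t) = (t < s).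
Proof. by rewrite lt_max ltxx subr_gt0. Qed.

Lemma cap_lipschitz s t t' : `|cap s t - cap s t'| <= `|t - t'|.
Proof.
rewrite /cap; have := ler_normr (t - t') (t - t'); rewrite lexx => /esym le1.
have le2 : t' - t <= `|t - t'| by rewrite -opprB lerNl lerNnormlW.
rewrite ler_norml; case: (leP 0 (s - t)); case: (leP 0 (s - t')) => *;
  by apply/andP; split; lra.
Qed.

Lemma separable_seq (w : X) : separable_space X ->
  exists c : nat -> X, forall (x : X) (U : set X), nbhs x U -> exists n, U (c n).
Proof.
move=> [D /countable_injP [f finj] dD].
exists (fun n => xget w [set x | D x /\ f x = n]) => x U nU.
have [y [Uy Dy]] : interior U `&` D !=set0.
  by apply: dD; [exists x|exact: open_interior].
exists (f y); case: xgetP => [z _ [Dz fzy]|/(_ y)[]//].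
suff -> : z = y by exact: interior_subset Uy.
by apply: finj => //; rewrite inE.
Qed.

(** The bumps are cones over balls of radius [1 / j.+1] about the points of a dense
    sequence, the balls that are not relatively compact being discarded. *)
Lemma bump_sequence (w : X) : locally_compact [set: X] -> polish R X ->
  exists phi : nat -> X -> R,
  [/\ forall n x, 0 <= phi n x <= 1,
      forall n, continuous (phi n),
      forall n, relcompact [set x | 0 < phi n x] &
      forall (x : X) U, nbhs x U ->
        exists n, 0 < phi n x /\ forall y, 0 < phi n y -> U y].
Proof.
move=> X_lc [/(separable_seq w)[c cP] [d [dm dt _]]].
pose s j : R := j.+1%:R^-1.
have s0 j : 0 < s j by rewrite invr_gt0.
pose phi n x := if unpickle n is Some (i, j) then
  if `[< relcompact [set y | d (c i) y < s j] >] then cap (s j) (d (c i) x)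
  else 0 else 0 : R.
exists phi; split.
- move=> n x; rewrite /phi; case: unpickle => [[i j]|]; last by rewrite lexx ler01.
  case: ifP => _; last by rewrite lexx ler01.
  rewrite cap_ge0 /= (le_trans (cap_le _ _)) ?metric_ge0//; first exact: ltW.
  by rewrite /s invf_le1 ?ler1n ?ltr0n.
- move=> n; apply: (lipschitz_metric_continuous dt) => x y; rewrite /phi.
  case: unpickle => [[i j]|]; last by rewrite subrr normr0 metric_ge0.
  case: ifP => _; last by rewrite subrr normr0 metric_ge0.
  exact: le_trans (cap_lipschitz _ _ _) (metric_distB dm _ _ _).
- move=> n; rewrite /phi; case: unpickle => [[i j]|]; last first.
    by apply: relcompactS (relcompact0 _) => x /=; rewrite ltxx.
  case: asboolP => [rc|_]; last first.
    by apply: relcompactS (relcompact0 _) => x /=; rewrite ltxx.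
  by apply: relcompactS rc => x /=; rewrite cap_gt0.
- move=> x U nU.
  have [K nK [cK _]] := X_lc x I.
  have nK' : nbhs x K by move: nK; rewrite withinET.
  have [e e0 eUK] := (iffLR (nbhs_metricP dt x (U `&` K))) (filterI nU nK').
  have [j sj] : exists j, s j < e / 2.
    have e20 : 0 < e / 2 by lra.
    have [N _ /(_ N (leqnn N)) sN] := near_infty_natSinv_lt (PosNum e20).
    by exists N.
  have [i /= xi] := cP x _ (nbhs_metric_ball dt x (s0 j)).
  have sub y : d (c i) y < s j -> (U `&` K) y.
    move=> iy; apply: eUK; have := metric_triangular dm x (c i) y; lra.
  have rc : relcompact [set y | d (c i) y < s j].
    by exists K => // y /sub[].
  exists (pickle (i, j)); rewrite /phi pickleK; case: asboolP => // _.
  split=> [|y]; rewrite cap_gt0; last by move=> /sub[].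
  by rewrite (metric_symmetric dm).
Qed.

End Bumps.

Section OrbitwiseSupremum.
Variables (R : realType) (G : topologicalGroupType) (X : topologicalType).
Variables (act : G -> X -> X) (phi : nat -> X -> R).
Hypotheses (act_action : is_action act) (act_continuous : continuous_action act).
Hypothesis act_proper : proper_action act.
Hypotheses (phi01 : forall n x, 0 <= phi n x <= 1)
  (phi_continuous : forall n, continuous (phi n))
  (phi_relcompact : forall n, relcompact [set x | 0 < phi n x])
  (phi_nbhs : forall (x : X) U, nbhs x U ->
     exists n, 0 < phi n x /\ forall y, 0 < phi n y -> U y).
Hypothesis X_lc : locally_compact [set: X].

(** Because of the factor [2^-1 ^+ n] only finitely many [n] matter at a given
    scale, which makes the suprema below continuous. *)
Definition orbit_bump (j : nat * G) (x : X) : R :=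
  2^-1 ^+ j.1 * phi j.1 (act j.2 x).

Definition orbit_dist x y : R :=
  sup (range (fun j => `|orbit_bump j x - orbit_bump j y|)).

(** If [y] is closer to [x] than this, then a translate of some bump is positive at
    both points ([orbit_dist_gt0_bump]), which confines [y] to a compact set. *)
Definition orbit_radius x : R := sup (range (orbit_bump ^~ x)).

Let j0 : nat * G := (0%N, 1%g).

Lemma orbit_bump_ge0 j x : 0 <= orbit_bump j x.
Proof.
rewrite mulr_ge0 ?exprn_ge0 ?invr_ge0//; by have /andP[] := phi01 j.1 (act j.2 x).
Qed.

Lemma orbit_bump_le j x : orbit_bump j x <= 2^-1 ^+ j.1.
Proof.
rewrite ler_piMr ?exprn_ge0 ?invr_ge0//; by have /andP[] := phi01 j.1 (act j.2 x).
Qed.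

Lemma orbit_bump_le1 j x : orbit_bump j x <= 1.
Proof.
apply: le_trans (orbit_bump_le j x) _.
by rewrite exprn_ile1 ?invr_ge0// invf_le1 ?ler1n.
Qed.

Lemma orbit_bump_act j g x :
  orbit_bump j (act g x) = orbit_bump (j.1, (j.2 * g)%g) x.
Proof. by rewrite /orbit_bump /= (proj2 act_action). Qed.

Lemma orbit_bumpB_le1 x y j : `|orbit_bump j x - orbit_bump j y| <= 1.
Proof.
have := orbit_bump_ge0 j x; have := orbit_bump_ge0 j y.
have := orbit_bump_le1 j x; have := orbit_bump_le1 j y.
by move=> *; rewrite ler_norml; apply/andP; split; lra.
Qed.

Lemma orbit_dist_ge j x y :
  `|orbit_bump j x - orbit_bump j y| <= orbit_dist x y.
Proof. exact: (le_sup_range j0 (orbit_bumpB_le1 x y)). Qed.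

Lemma orbit_dist_le x y M :
  (forall j, `|orbit_bump j x - orbit_bump j y| <= M) -> orbit_dist x y <= M.
Proof. exact: (sup_range_le j0). Qed.

Lemma orbit_distC x y : orbit_dist x y = orbit_dist y x.
Proof.
have sub x' y' : orbit_dist x' y' <= orbit_dist y' x'.
  by apply: orbit_dist_le => j; rewrite distrC; exact: orbit_dist_ge.
by apply/eqP; rewrite eq_le !sub.
Qed.

Lemma orbit_radius_ge j x : orbit_bump j x <= orbit_radius x.
Proof. exact: (le_sup_range j0 (orbit_bump_le1 ^~ x)). Qed.

Lemma orbit_radius_gt0 x : 0 < orbit_radius x.
Proof.
have [n [n0 _]] := phi_nbhs (@filterT _ (nbhs x) _).
apply: lt_le_trans (orbit_radius_ge (n, 1%g) x).
by rewrite /orbit_bump /= (proj1 act_action) mulr_gt0// exprn_gt0 ?invr_gt0.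
Qed.

Lemma orbit_radius_le1 x : orbit_radius x <= 1.
Proof. exact: (sup_range_le j0 (orbit_bump_le1 ^~ x)). Qed.

Lemma orbit_radius_lipschitz x y :
  `|orbit_radius x - orbit_radius y| <= orbit_dist x y.
Proof.
have sub x' y' : orbit_radius x' <= orbit_radius y' + orbit_dist x' y'.
  apply: (sup_range_le j0) => j.
  have := orbit_radius_ge j y'; have := orbit_dist_ge j x' y'.
  rewrite ler_norml => /andP[_]; lra.
have := sub x y; have := sub y x.
rewrite (orbit_distC y x).
by move=> *; rewrite ler_norml; apply/andP; split; lra.
Qed.

(** Translation by [g] permutes the functions over which the supremum is taken. *)
Lemma orbit_dist_act g x y :
  orbit_dist (act g x) (act g y) = orbit_dist x y.
Proof.
have sub h x' y' : orbit_dist (act h x') (act h y') <= orbit_dist x' y'.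
  by apply: orbit_dist_le => j; rewrite !orbit_bump_act; exact: orbit_dist_ge.
apply/eqP; rewrite eq_le sub /=.
by have := sub g^-1%g (act g x) (act g y); rewrite !actK.
Qed.

Lemma orbit_radius_act g x : orbit_radius (act g x) = orbit_radius x.
Proof.
have sub h x' : orbit_radius (act h x') <= orbit_radius x'.
  by apply: (sup_range_le j0) => j; rewrite !orbit_bump_act; exact: orbit_radius_ge.
apply/eqP; rewrite eq_le sub /=.
by have := sub g^-1%g (act g x); rewrite actK.
Qed.

Lemma orbit_dist_gt0_bump j x y : orbit_dist x y < orbit_bump j x ->
  0 < phi j.1 (act j.2 y).
Proof.
move=> lt_d; have := orbit_dist_ge j x y; rewrite ler_norml => /andP[_ le_d].
have : 0 < orbit_bump j y by lra.
by rewrite pmulr_rgt0// exprn_gt0 ?invr_gt0.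
Qed.

Hypothesis X_T2 : hausdorff_space X.

Lemma orbit_dist_metric : is_metric orbit_dist.
Proof.
split.
- move=> x; apply/eqP; rewrite eq_le; apply/andP; split.
    by apply: orbit_dist_le => j; rewrite subrr normr0.
  exact: le_trans (normr_ge0 _) (orbit_dist_ge j0 x x).
- move=> x y xy0; apply: X_T2 => A B nA nB.
  have [n [nx nA']] := phi_nbhs nA; exists y; split; last exact: nbhs_singleton.
  apply: nA'; have := @orbit_dist_gt0_bump (n, 1%g) x y.
  rewrite /orbit_bump /= !(proj1 act_action); apply.
  by rewrite xy0 mulr_gt0// exprn_gt0 ?invr_gt0.
- exact: orbit_distC.
- move=> x y z; apply: orbit_dist_le => j.
  have := orbit_dist_ge j x y; have := orbit_dist_ge j y z.
  have := ler_distD (orbit_bump j y) (orbit_bump j x) (orbit_bump j z); lra.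
Qed.

(** Uniformly in [g], because the [g] that bring a neighbourhood of [x] into the
    support of [phi n] form a compact set. *)
Lemma near_bump_uniform n x (e : R) : 0 < e ->
  \forall y \near x, forall g, `|phi n (act g x) - phi n (act g y)| < e.
Proof.
move=> e0.
have [U nU [cU _]] := X_lc (I : [set: X] x).
rewrite withinET in nU.
have [K cK phiK] := phi_relcompact n.
(* Outside [C] both bumps vanish. *)
set C := [set g | exists2 y, U y & K (act g y)].
have cC : compact C by exact: transporter_compact.
have nearC : \forall y \near x, C `<=`
    (fun g => `|phi n (act g x) - phi n (act g y)| < e).
  apply: ((iffLR (compact_near_coveringP C)) cC X (nbhs x)
    (fun y g => `|phi n (act g x) - phi n (act g y)| < e)).
  move=> g _.
  have cvg1 : phi n (act p.1 p.2) @[p --> (g, x)] --> phi n (act g x).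
    apply: continuous_cvg; first exact: phi_continuous.
    exact: (@act_continuous (g, x)).
  have cvg2 : phi n (act p.1 x) @[p --> (g, x)] --> phi n (act g x).
    apply: continuous_cvg; first exact: phi_continuous.
    by apply: (act_cvg act_continuous); [exact: cvg_fst|exact: cvg_cst].
  have e2 : 0 < e / 2 by lra.
  move/cvgrPdist_lt: cvg1 => /(_ _ e2) near1.
  move/cvgrPdist_lt: cvg2 => /(_ _ e2) near2.
  apply: (@filterS _ (nbhs (g, x)) _ _ _ _ (filterI near1 near2)) => -[h y] /= [h1 h2].
  have := ler_distD (phi n (act g x)) (phi n (act h x)) (phi n (act h y)).
  rewrite (distrC (phi n (act h x)) (phi n (act g x))); lra.
near=> y => g.
have [Cg|nCg] := pselect (C g); first by apply: (near nearC y _) Cg.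
have phi0 z : U z -> phi n (act g z) = 0.
  move=> Uz; apply/eqP; rewrite eq_le; have /andP[-> _] := phi01 n (act g z).
  rewrite andbT leNgt; apply/negP => /phiK Kz; apply: nCg; by exists z.
by rewrite !phi0 ?subrr ?normr0//; [exact: (near nU y)|exact: nbhs_singleton].
Unshelve. all: by end_near. Qed.

Lemma orbit_dist_topology : induces_topology orbit_dist.
Proof.
apply/induces_topologyP => x U; split.
  move=> nU; have [n [nx nU']] := phi_nbhs nU.
  exists (orbit_bump (n, 1%g) x) => [|y /orbit_dist_gt0_bump].
    by rewrite /orbit_bump /= (proj1 act_action) mulr_gt0// exprn_gt0 ?invr_gt0.
  by rewrite /= (proj1 act_action) => /nU'.
move=> [e e0 eU].
have e2 : 0 < e / 2 by lra.
have [N smallN] : exists N, forall n, (N <= n)%N -> (2^-1 : R) ^+ n < e / 2.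
  have : (2^-1 : R) ^+ n @[n --> \oo] --> (0 : R).
    by apply: cvg_expr; rewrite ger0_norm ?invr_ge0// invf_lt1 ?ltr1n.
  move=> /cvgrPdist_lt /(_ _ e2) [N _ HN]; exists N => n /HN /=.
  by rewrite sub0r normrN ger0_norm ?exprn_ge0 ?invr_ge0.
have near_le : \forall y \near x, forall n, (n < N)%N -> forall g,
    `|phi n (act g x) - phi n (act g y)| < e / 2.
  elim: N {smallN} => [|N IH]; first by near=> y.
  near=> y => n; rewrite ltnS leq_eqVlt => /orP[/eqP ->|nN].
    by apply: (near (near_bump_uniform N x e2) y).
  by apply: (near IH y).
apply: filterS near_le => y near_y; apply: eU.
apply: (@le_lt_trans _ _ (e / 2)); last by lra.
apply: orbit_dist_le => -[n g].
have [nN|Nn] := ltnP n N.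
  rewrite /orbit_bump /= -mulrBr normrM ger0_norm ?exprn_ge0 ?invr_ge0//.
  apply: le_trans (ltW (near_y n nN g)); apply: ler_piMl => //.
  by rewrite exprn_ile1 ?invr_ge0// invf_le1 ?ler1n.
have := orbit_bump_ge0 (n, g) x; have := orbit_bump_ge0 (n, g) y.
have := orbit_bump_le (n, g) x; have := orbit_bump_le (n, g) y.
have := smallN n Nn => /=.
by move=> *; rewrite ler_norml; apply/andP; split; lra.
Unshelve. all: by end_near. Qed.

Lemma orbit_radius_continuous : continuous orbit_radius.
Proof.
exact: (lipschitz_metric_continuous orbit_dist_topology orbit_radius_lipschitz).
Qed.

(** A bump that nearly attains the supremum at [x] stays positive at every point
    that is half a radius away from a point close to [x]. *)
Lemma orbit_ball_tame :
  tame (fun x => [set y | orbit_dist x y < orbit_radius x / 2]).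
Proof.
apply: tame_local => x; set r := orbit_radius x.
have r0 : 0 < r := orbit_radius_gt0 x.
have lt_r : 3/4 * r < r by lra.
have [j rj] := lt_sup_range j0 (orbit_bump_le1 ^~ x) lt_r.
exists [set y | orbit_dist x y < orbit_bump j x - 3/4 * r /\ orbit_dist x y < r / 4].
  by apply: filterI; apply: (nbhs_metric_ball orbit_dist_topology); lra.
have rc : relcompact (act j.2^-1%g @` [set y | 0 < phi j.1 y]).
  have [K cK phiK] := phi_relcompact j.1.
  exists (act j.2^-1%g @` K); last exact: image_subset.
  apply: continuous_compact cK; apply: continuous_subspaceT.
  exact: act_continuousr.
apply: relcompactS rc => z [y [/= xy1 xy2] yz].
exists (act j.2 z); last exact: actK.
apply: (@orbit_dist_gt0_bump j y z); apply: lt_trans yz _.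
have := orbit_radius_lipschitz x y; have := orbit_dist_ge j x y.
rewrite !ler_norml => /andP[_ h1] /andP[h2 _].
rewrite -/r in h2; lra.
Qed.

End OrbitwiseSupremum.

(** * Chain metrics *)

Section ChainMetric.
Variables (R : realType) (X : topologicalType).
Variables (rho : X -> X -> R) (h : X -> R) (S : nat -> X -> set X).

(** Below, [h] is the inverse of [orbit_radius], so the last summand measures a step
    in units of the local radius; the first one keeps these units comparable
    along a cheap chain. *)
Definition short_cost x y : R := `|h x - h y| + (h x + h y) * rho x y.

(** Jumps are there because chains of short steps need not connect two points; they
    cost at least 1, hence do not affect small distances. *)
Definition long_cost x y : R := 1 + inf [set m%:R | m in [set m | S m x y]].

Definition step_cost x y : R :=
  if short_cost x y < 1/4 then short_cost x y else long_cost x y.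

Fixpoint chain_cost x (s : seq X) : R :=
  if s is y :: s' then step_cost x y + chain_cost y s' else 0.

Definition chain_inf x y : R :=
  inf [set chain_cost x s | s in [set s | last x s = y]].

(** Adding the two directions gives symmetry without reversing chains. *)
Definition chain_metric x y : R := chain_inf x y + chain_inf y x.

Hypotheses (rho_metric : is_metric rho) (rho_topology : induces_topology rho).
Hypotheses (h_ge1 : forall x, 1 <= h x) (h_continuous : continuous h).
Hypothesis near_tame : tame (fun x => [set y | h x * rho x y < 1/2]).
Hypotheses (S_sym : forall m x y, S m x y -> S m y x)
  (S_tame : forall m, tame (S m))
  (S_homo : forall m n x, (m <= n)%N -> S m x `<=` S n x)
  (S_total : forall x y, exists m, S m x y).

Lemma short_cost_ge0 x y : 0 <= short_cost x y.
Proof.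
rewrite addr_ge0// mulr_ge0 ?(metric_ge0 rho_metric)//.
have := h_ge1 x; have := h_ge1 y; lra.
Qed.

Lemma long_cost_ge1 x y : 1 <= long_cost x y.
Proof.
rewrite lerDl; apply: lb_le_inf; last by move=> _ [m _ <-].
by have [m Sm] := S_total x y; exists m%:R, m.
Qed.

Lemma long_cost_lt x y (M : nat) : long_cost x y < M%:R -> S M x y.
Proof.
rewrite /long_cost => lt_M.
have hi : has_inf [set (m%:R : R) | m in [set m | S m x y]].
  split; first by have [m Sm] := S_total x y; exists m%:R, m.
  by exists 0 => _ [m _ <-].
have [_ [m Sm <-]] := inf_adherent (@ltr01 R) hi.
rewrite addrC => /lt_trans /(_ lt_M); rewrite ltr_nat => /ltnW mM.
exact: S_homo mM _ Sm.
Qed.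

Lemma step_cost_ge0 x y : 0 <= step_cost x y.
Proof.
rewrite /step_cost; case: ifP => _; first exact: short_cost_ge0.
exact: le_trans (long_cost_ge1 x y).
Qed.

Lemma step_costC x y : step_cost x y = step_cost y x.
Proof.
have -> : step_cost x y =
    if short_cost y x < 1/4 then short_cost y x else long_cost y x.
  rewrite /step_cost.
  have -> : short_cost x y = short_cost y x.
    by rewrite /short_cost distrC addrC [h x + _]addrC (metric_symmetric rho_metric) addrC.
  suff -> : long_cost x y = long_cost y x by [].
  congr (1 + inf _); apply/seteqP.
  by split=> _ [m Sm <-]; exists m => //; exact: S_sym.
by [].
Qed.

(** A step of bounded cost is either short, and then stays within the local radius,
    or a jump along some [S N]. *)
Lemma step_cost_tame M : tame (fun x => [set y | step_cost x y < M]).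
Proof.
have [N MN] : exists N : nat, M <= N%:R.
  by exists (Num.trunc M).+1; apply: ltW; exact: truncnS_gt.
apply: (tameS _ (tameU near_tame (S_tame N))) => x y /=.
rewrite /step_cost; case: ifP => [small _|_ lt_M]; last first.
  by right; apply: long_cost_lt; exact: lt_le_trans MN.
left; apply: le_lt_trans (_ : short_cost x y < _); last by lra.
rewrite /short_cost; have := metric_ge0 rho_metric x y.
have := normr_ge0 (h x - h y); have := h_ge1 y; nra.
Qed.

Lemma chain_cost_ge0 x s : 0 <= chain_cost x s.
Proof.
by elim: s x => //= y s IH x; rewrite addr_ge0 ?step_cost_ge0.
Qed.

Lemma chain_cost_cat x s t :
  chain_cost x (s ++ t) = chain_cost x s + chain_cost (last x s) t.
Proof. by elim: s x => [|y s IH] x /=; rewrite ?add0r// IH addrA. Qed.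

(** [H] bounds [h] from below all along the chain, since [h] drops by at most the
    cost that has been spent. *)
Lemma small_chain x s H : 0 < H -> chain_cost x s < 1/4 ->
  H + chain_cost x s <= h x -> H * rho x (last x s) <= chain_cost x s.
Proof.
move=> H0; elim: s x => [|y s IH] x /=.
  by rewrite (metric_refl rho_metric) mulr0.
have := chain_cost_ge0 y s; set c := chain_cost y s => c0 small le_h.
have short : step_cost x y = short_cost x y.
  rewrite /step_cost; case: ifP => // nsmall.
  by have := long_cost_ge1 x y; move: small; rewrite /step_cost nsmall; lra.
rewrite short in small le_h *.
have rho0 := metric_ge0 rho_metric x y.
have sc0 : `|h x - h y| <= short_cost x y.
  by rewrite lerDl mulr_ge0//; have := h_ge1 x; have := h_ge1 y; lra.
have le_hy : H + c <= h y by move: sc0; rewrite ler_norml => /andP[_]; lra.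
have small' : c < 1/4 by have := short_cost_ge0 x y; lra.
have := IH y small' le_hy; rewrite -/c => le_c.
have le_sc : H * rho x y <= short_cost x y.
  rewrite /short_cost; have := normr_ge0 (h x - h y).
  have := short_cost_ge0 x y; have := h_ge1 y; nra.
have := metric_triangular rho_metric x y (last y s); nra.
Qed.

(** [H] bounds [h] from below all along the chain, since [h] drops by at most the
    cost that has been spent. *)
Lemma small_chain_rho x s : chain_cost x s < 1/4 ->
  3/4 * rho x (last x s) <= chain_cost x s.
Proof.
by move=> small; apply: small_chain => //; have := h_ge1 x; lra.
Qed.

(** [H] bounds [h] from below all along the chain, since [h] drops by at most the
    cost that has been spent. *)
Lemma small_chain_near x s : chain_cost x s < 1/4 ->
  h x * rho x (last x s) < 1/2.
Proof.
move=> small; have hx := h_ge1 x.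
have H0 : 0 < h x - chain_cost x s by lra.
have := small_chain H0 small; rewrite subrK => /(_ (lexx _)).
have := metric_ge0 rho_metric x (last x s); have := chain_cost_ge0 x s; nra.
Qed.

(** The chain is cut at the step by which its cost reaches [a]. *)
Lemma chain_split a x s : 0 < a -> a <= chain_cost x s ->
  exists s1 z s2, [/\ s = s1 ++ z :: s2, chain_cost x s1 < a &
    a <= chain_cost x s1 + step_cost (last x s1) z].
Proof.
elim: s x a => [|y s IH] x a a0 /=; first by rewrite leNgt a0.
move=> le_a; have [small|big] := ltP (step_cost x y) a; last first.
  by exists [::], y, s; split; rewrite //= add0r.
have [||s1 [z [s2 [-> lt1 le2]]]] := IH y (a - step_cost x y).
- by rewrite subr_gt0.
- by rewrite lerBlDl.
by exists (y :: s1), z, s2; split => //=; lra.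
Qed.

(** A chain of cost below [k.+1 / 4] is cut into a chain of cost below [k / 4], one
    step, and a remainder of cost below [1 / 4], which stays near its start. *)
Lemma chain_ball_tame k :
  tame (fun x => [set last x s | s in [set s | chain_cost x s < k%:R / 4]]).
Proof.
elim: k => [|k IH].
  move=> K cK; apply: relcompactS (relcompact0 _) => _ [x _ [s /= lt0 _]].
  by have := chain_cost_ge0 x s; lra.
have tame1 : tame (fun x => [set last x s | s in [set s | chain_cost x s < 1/4]]).
  by apply: tameS near_tame => x _ [s /= lt1 <-]; exact: small_chain_near.
apply: (tameS _ (tameU (tameU IH tame1)
  (tame_comp (tame_comp IH (step_cost_tame (k.+1%:R / 4))) tame1))).
move=> x _ [s /= lt_s <-].
have [lt_k|le_k] := ltP (chain_cost x s) (k%:R / 4).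
  by left; left; exists s.
have [k0|k0] := leqP k 0.
  left; right; exists s => //=; by move: k0 lt_s; rewrite leqn0 => /eqP ->.
have k0' : 0 < k%:R / 4 :> R by rewrite divr_gt0 ?ltr0n.
have [s1 [z [s2 [eq_s lt1 le2]]]] := chain_split k0' le_k.
move: lt_s; rewrite eq_s chain_cost_cat /= last_cat /= -[k.+1]addn1 natrD => lt_s.
have := chain_cost_ge0 x s1; have := chain_cost_ge0 z s2 => c2 c1.
right; exists z; last by exists s2 => //=; lra.
by exists (last x s1); [exists s1|rewrite /=; lra].
Qed.

Let chain_has_inf x y :
  has_inf [set chain_cost x s | s in [set s | last x s = y]].
Proof.
split; first by exists (chain_cost x [:: y]), [:: y].
by exists 0 => _ [s _ <-]; exact: chain_cost_ge0.
Qed.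

Lemma chain_inf_le x s : chain_inf x (last x s) <= chain_cost x s.
Proof. by apply: (ge_inf (proj2 (chain_has_inf x (last x s)))); exists s. Qed.

Lemma chain_inf_ge0 x y : 0 <= chain_inf x y.
Proof.
apply: lb_le_inf (proj1 (chain_has_inf x y)) _ => _ [s _ <-].
exact: chain_cost_ge0.
Qed.

Lemma chain_inf_lt x y M : chain_inf x y < M ->
  exists2 s, last x s = y & chain_cost x s < M.
Proof.
move=> lt_M; have e0 : 0 < M - chain_inf x y by rewrite subr_gt0.
have [_ [s ls <-]] := inf_adherent e0 (chain_has_inf x y).
by rewrite addrC subrK => ?; exists s.
Qed.

Lemma chain_inf_triangular x y z :
  chain_inf x z <= chain_inf x y + chain_inf y z.
Proof.
apply/ler_addgt0Pr => e e0; have lt_e v : v < v + e / 2 by lra.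
have [s last_s s_lt] := chain_inf_lt (lt_e (chain_inf x y)).
have [t last_t t_lt] := chain_inf_lt (lt_e (chain_inf y z)).
have := chain_inf_le x (s ++ t); rewrite last_cat chain_cost_cat last_s last_t; lra.
Qed.

Lemma chain_metric_near x y e : e <= 1/4 -> chain_metric x y < e ->
  3/4 * rho x y < e.
Proof.
move=> e4 lt_e; have := chain_inf_ge0 y x => y0.
have [|s <- s_lt] := @chain_inf_lt x y e; first by rewrite /chain_metric in lt_e; lra.
by apply: (le_lt_trans (small_chain_rho _) s_lt); lra.
Qed.

Lemma chain_metric_is_metric : is_metric chain_metric.
Proof.
split.
- move=> x; have := chain_inf_ge0 x x; have := chain_inf_le x [::].
  by rewrite /chain_metric /=; lra.
- move=> x y xy0; apply: (metric_positivity rho_metric); apply/eqP.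
  rewrite eq_le (metric_ge0 rho_metric) andbT leNgt; apply/negP => rho0.
  set e := Num.min (1/4) (3/4 * rho x y).
  have e0 : 0 < e by rewrite lt_min; apply/andP; split; lra.
  have := @chain_metric_near x y e; rewrite xy0 ge_min lexx => /(_ isT e0).
  by rewrite lt_min ltxx andbF.
- by move=> x y; rewrite /chain_metric addrC.
- move=> x y z; rewrite /chain_metric.
  have := chain_inf_triangular x y z; have := chain_inf_triangular z y x; lra.
Qed.

Lemma short_cost_continuous x : continuous (short_cost x).
Proof.
move=> y; apply: cvgD.
  by apply: cvg_norm; apply: cvgB; [exact: cvg_cst|exact: h_continuous].
apply: cvgM; last exact: (metric_continuous rho_metric rho_topology).
by apply: cvgD; [exact: cvg_cst|exact: h_continuous].
Qed.

Lemma chain_metric_topology : induces_topology chain_metric.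
Proof.
apply/induces_topologyP => x U; split.
  move=> /(nbhs_metricP rho_topology) [e e0 eU].
  exists (Num.min (1/4) (3/4 * e)).
    by rewrite lt_min; apply/andP; split; lra.
  move=> y lt_e; apply: eU.
  have := chain_metric_near _ lt_e; rewrite ge_min lexx => /(_ isT).
  by rewrite lt_min => /andP[_]; lra.
move=> [e e0 eU].
have sc0 : short_cost x x = 0.
  by rewrite /short_cost subrr normr0 (metric_refl rho_metric) mulr0 addr0.
have [m0 me] : 0 < Num.min (1/4) (e / 2) /\ Num.min (1/4) (e / 2) <= e / 2.
  by rewrite lt_min ge_min lexx orbT; split => //; apply/andP; split; lra.
have /cvgrPdist_lt /(_ _ m0) := @short_cost_continuous x x.
apply: filterS => y /=; rewrite sc0 sub0r normrN ger0_norm ?short_cost_ge0//.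
move=> lt_m; apply: eU.
have lt4 : short_cost x y < 1/4 by move: lt_m; rewrite lt_min => /andP[].
have := chain_inf_le x [:: y]; have := chain_inf_le y [:: x].
rewrite /= !addr0 (step_costC y x) /step_cost lt4 /chain_metric; lra.
Qed.

Lemma chain_metric_proper : proper_metric chain_metric.
Proof.
move=> x r.
apply: (metric_closed_ball_compact chain_metric_is_metric chain_metric_topology).
have [N rN] : exists N : nat, 4 * r < N%:R.
  by exists (Num.trunc (4 * r)).+1; exact: truncnS_gt.
apply: relcompactS (@chain_ball_tame N _ (@compact_set1 _ x)) => y /= le_r.
exists x => //; have := chain_inf_ge0 y x => y0.
have [|s ls s_lt] := @chain_inf_lt x y (N%:R / 4).
  by rewrite /chain_metric in le_r; lra.
by exists s.
Qed.

Lemma chain_metric_Metr_c : Metr_c chain_metric.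
Proof.
split; [exact: chain_metric_is_metric|exact: chain_metric_topology|].
exact: chain_metric_proper.
Qed.

Lemma chain_inf_homo (g : X -> X) :
  (forall x y, step_cost (g x) (g y) = step_cost x y) ->
  forall x y, chain_inf (g x) (g y) <= chain_inf x y.
Proof.
move=> gcost x y; apply: lb_le_inf (proj1 (chain_has_inf x y)) _ => _ [s <- <-].
rewrite -last_map.
have -> : chain_cost x s = chain_cost (g x) (map g s).
  by elim: s x {y} => //= z s IH x; rewrite gcost IH.
exact: chain_inf_le.
Qed.

End ChainMetric.

(** * An invariant proper metric *)

Section InvariantProperMetric.

(** The jumps of level [m] join points that a common element of [G] brings into the
    union of the supports of the first [m] bumps; they form a tame relation
    because the action is proper. *)
Theorem invariant_proper_metric (R : realType) (G : topologicalGroupType)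
    (X : topologicalType) (act : G -> X -> X) (w : X) :
  locally_compact [set: X] -> polish R X -> is_action act ->
  continuous_action act -> proper_action act ->
  exists2 rho : X -> X -> R, Metr_c rho &
    forall g x y, rho (act g x) (act g y) = rho x y.
Proof.
move=> X_lc X_polish act_action act_cont act_proper.
have X_T2 : hausdorff_space X.
  by have [_ [d [dm dt _]]] := X_polish; exact: (@inducing_metric_T2 _ _ d dm dt).
have [phi [phi01 phi_cont phi_rc phi_nbhs]] := bump_sequence w X_lc X_polish.
pose rho0 := orbit_dist act phi; pose r := orbit_radius act phi.
have rho0m : is_metric rho0 := orbit_dist_metric act_action phi01 phi_nbhs X_T2.
have rho0t : induces_topology rho0 :=
  orbit_dist_topology act_action act_cont act_proper phi01 phi_cont phi_rc phi_nbhs X_lc.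
have r0 x : 0 < r x := orbit_radius_gt0 act_action phi01 phi_nbhs x.
have r1 x : r x <= 1 := orbit_radius_le1 act phi01 x.
have r_cont : continuous r := orbit_radius_continuous act_action act_cont
  act_proper phi01 phi_cont phi_rc phi_nbhs X_lc.
have r_tame : tame (fun x => [set y | rho0 x y < r x / 2]) := orbit_ball_tame
  act_action act_cont act_proper phi01 phi_cont phi_rc phi_nbhs X_lc.
pose h x := (r x)^-1.
have h1 x : 1 <= h x by rewrite invf_ge1.
have h_cont : continuous h.
  by move=> x; apply: cvgV; [rewrite gt_eqF|exact: r_cont].
have h_tame : tame (fun x => [set y | h x * rho0 x y < 1/2]).
  apply: tameS r_tame => x y /=.
  by rewrite mulrC ltr_pdivrMr// mul1r [2^-1 * _]mulrC.
pose L m := [set x | exists2 n, (n < m)%N & 0 < phi n x].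
have L_rc m : relcompact (L m).
  elim: m => [|m IH]; first by apply: relcompactS (relcompact0 _) => x [].
  apply: relcompactS (relcompactU IH (phi_rc m)) => x [n].
  rewrite ltnS leq_eqVlt => /orP[/eqP->|nm] n0; first by right.
  by left; exists n.
pose S m x := [set y | exists g, L m (act g x) /\ L m (act g y)].
have S_sym m x y : S m x y -> S m y x by move=> [g [Lx Ly]]; exists g.
have S_tame m : tame (S m).
  have [K cK LK] := L_rc m.
  apply: tameS (saturation_tame act_action act_cont act_proper cK) => x y.
  by move=> [g [/LK Kx /LK Ky]]; exists g.
have LS m n : (m <= n)%N -> L m `<=` L n.
  by move=> mn x [k km k0]; exists k => //; exact: leq_trans mn.
have S_homo m n x : (m <= n)%N -> S m x `<=` S n x.
  by move=> mn y [g [Lx Ly]]; exists g; split; exact: (LS _ _ mn).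
have L_cover x : exists m, L m x.
  have [n [n0 _]] := phi_nbhs x setT filterT.
  by exists n.+1, n.
have S_total x y : exists m, S m x y.
  have [m Lx] := L_cover x; have [n Ly] := L_cover y.
  exists (maxn m n), 1%g; rewrite !(proj1 act_action).
  by split; [exact: (LS _ _ (leq_maxl _ _))|exact: LS (leq_maxr _ _) _ _].
exists (chain_metric rho0 h S).
  exact: chain_metric_Metr_c.
have S_act m g x y : S m (act g x) (act g y) <-> S m x y.
  rewrite /S /=; split=> [[k [Lx Ly]]|[k [Lx Ly]]].
    by exists (k * g)%g; rewrite !(proj2 act_action).
  by exists (k * g^-1)%g; rewrite !(proj2 act_action) !actK.
have cost_act g x y :
    step_cost rho0 h S (act g x) (act g y) = step_cost rho0 h S x y.
  have -> : step_cost rho0 h S (act g x) (act g y) =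
      if short_cost rho0 h x y < 1/4 then short_cost rho0 h x y
      else long_cost R S (act g x) (act g y).
    by rewrite /step_cost /short_cost /h /r /rho0 !orbit_radius_act// orbit_dist_act.
  rewrite /step_cost; case: ifP => // _; rewrite /long_cost; congr (1 + inf _).
  apply/seteqP; split=> _ [m Sm <-]; exists m => //.
    exact: (iffLR (S_act m g x y)).
  exact: (iffRL (S_act m g x y)).
have inf_act g x y : chain_inf rho0 h S (act g x) (act g y) = chain_inf rho0 h S x y.
  have le k a b : chain_inf rho0 h S (act k a) (act k b) <= chain_inf rho0 h S a b.
    exact: (chain_inf_homo rho0m h1 S_total (cost_act k)).
  apply/eqP; rewrite eq_le le /=.
  by have := le g^-1%g (act g x) (act g y); rewrite !actK.
by move=> g x y; rewrite /chain_metric !inf_act.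
Qed.

End InvariantProperMetric.

(** * Series with geometrically bounded terms *)

Section OctalSeries.
Variable R : realType.

(** The ratio 8 leaves room for labels that are only known up to a factor 4, and the
    sum of all terms is small enough for two such series to be added to a metric. *)
Definition octal n : R := 8^-1 ^+ n.+1.

Lemma octal_gt0 n : 0 < octal n.
Proof. by rewrite exprn_gt0// invr_gt0. Qed.

Lemma octalS n : octal n.+1 = octal n / 8.
Proof. by rewrite /octal exprSr. Qed.

Lemma octal_lt m n : (m < n)%N -> 8 * octal n <= octal m.
Proof.
elim: n => // n IH; rewrite ltnS leq_eqVlt octalS => /orP[/eqP ->|/IH].
  by have := octal_gt0 n; have := octal_gt0 m; lra.
by have := octal_gt0 n; lra.
Qed.

Lemma sum_octal m n : (m <= n)%N -> \sum_(m <= i < n) octal i <= 2 * octal m.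
Proof.
move=> mn.
suff : \sum_(m <= i < n) octal i <= 8/7 * octal m - 8/7 * octal n.
  by have := octal_gt0 n; have := octal_gt0 m; lra.
elim: n mn => [|n IH].
  by rewrite leqn0 => /eqP ->; rewrite big_geq//; have := octal_gt0 0; lra.
rewrite leq_eqVlt => /orP[/eqP <-|].
  by rewrite big_geq//; have := octal_gt0 m; lra.
rewrite ltnS => mn; rewrite big_nat_recr//= octalS.
by have := IH mn; have := octal_gt0 n; lra.
Qed.

Lemma sum_octal0 n : \sum_(i < n) octal i <= 1/4.
Proof.
rewrite -(big_mkord xpredT octal); apply: le_trans (sum_octal (leq0n n)) _.
by rewrite /octal expr1; lra.
Qed.

Lemma octal_small (e : R) : 0 < e -> exists n, octal n < e.
Proof.
move=> e0.
have : (8^-1 : R) ^+ n @[n --> \oo] --> (0 : R).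
  by apply: cvg_expr; rewrite ger0_norm ?invr_ge0// invf_lt1 ?ltr1n.
move=> /cvgrPdist_lt /(_ _ e0) [N _ HN]; exists N.
have /= := HN N.+1 (leqnSn N).
by rewrite sub0r normrN ger0_norm// ?exprn_ge0 ?invr_ge0.
Qed.

Section Bounded.
Variable x : nat -> R.
Hypothesis x_octal : forall n, 0 <= x n <= octal n.

Lemma series_octal_cvg : cvgn (series x).
Proof.
apply: nondecreasing_is_cvgn.
  apply/nondecreasing_seqP => n; rewrite seriesEord /= big_ord_recr /= lerDl.
  by have /andP[] := x_octal n.
exists (1/4) => _ [n _ <-]; rewrite seriesEord /=.
apply: le_trans (sum_octal0 n); apply: ler_sum => i _.
by have /andP[] := x_octal i.
Qed.

Lemma series_octal_ge0 : 0 <= limn (series x).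
Proof.
apply: limr_ge; first exact: series_octal_cvg.
apply: nearW => n; rewrite seriesEord /=; apply: sumr_ge0 => i _.
by have /andP[] := x_octal i.
Qed.

End Bounded.

(** Finitely many partial sums may be ignored, so that the first [m] terms and
    the rest can be estimated separately. *)
Lemma series_octal_dist (x y : nat -> R) (m : nat) (M : R) :
  (forall n, 0 <= x n <= octal n) -> (forall n, 0 <= y n <= octal n) ->
  (forall N, (m <= N)%N -> `|\sum_(i < N) (x i - y i)| <= M) ->
  `|limn (series x) - limn (series y)| <= M.
Proof.
move=> x_oct y_oct le_M.
have cx := series_octal_cvg x_oct; have cy := series_octal_cvg y_oct.
rewrite -limB//.
have cxy : cvgn (series x - series y) by exact: is_cvgB.
rewrite -lim_norm//; apply: limr_le; first exact: is_cvg_norm.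
exists m => // N /= /le_M; rewrite !fctE !seriesEord /=.
by rewrite sumrB.
Qed.

Lemma series_octal_single (x : nat -> R) k :
  (forall n, 0 <= x n <= octal n) ->
  limn (series x) = x k + limn (series (fun n => if n == k then 0 else x n)).
Proof.
move=> x_oct; set y := fun n => _.
have y_oct n : 0 <= y n <= octal n.
  by rewrite /y; case: eqP => // _; rewrite lexx ltW ?octal_gt0.
pose z n := if n == k then x k else 0.
have cz : series z @ \oo --> x k.
  apply: cvg_near_cst; exists k.+1 => // N /= kN; rewrite seriesEord /=.
  rewrite (bigD1 (Ordinal kN))//= /z eqxx big1 ?addr0// => i.
  by rewrite -val_eqE /= => /negPf ->.
have -> : series x = series z + series y.
  apply/funext => N; rewrite !fctE !seriesEord -big_split /=.
  by apply: eq_bigr => i _; rewrite /z /y; case: eqP => [->|]; rewrite ?addr0 ?add0r.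
by rewrite (cvg_lim _ (cvgD cz (series_octal_cvg y_oct))).
Qed.

Lemma series0 (x : nat -> R) : (forall n, x n = 0) -> limn (series x) = 0.
Proof.
move=> x0; have -> : series x = cst 0; last exact: lim_cst.
by apply/funext => N; rewrite seriesEord /= big1.
Qed.

End OctalSeries.

(** * The square root of a metric *)

Section Snowflake.
Variables (R : realType) (X : topologicalType) (rho : X -> X -> R).

Definition snow x y : R := Num.sqrt (rho x y).

Definition pair_rho (P Q : X * X) : R := rho P.1 Q.1 + rho P.2 Q.2.

(** The metric on pairs against which slopes are measured; its square is comparable
    with [pair_rho]. *)
Definition pair_snow (P Q : X * X) : R := snow P.1 Q.1 + snow P.2 Q.2.

Hypothesis rho_metric : is_metric rho.

Lemma snow_ge0 x y : 0 <= snow x y.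
Proof. exact: sqrtr_ge0. Qed.

Lemma sqr_snow x y : snow x y ^+ 2 = rho x y.
Proof. by rewrite sqr_sqrtr// metric_ge0. Qed.

Lemma snowC x y : snow x y = snow y x.
Proof. by rewrite /snow (metric_symmetric rho_metric). Qed.

Lemma snow_refl x : snow x x = 0.
Proof. by rewrite /snow (metric_refl rho_metric) sqrtr0. Qed.

Lemma snow_eq0 x y : snow x y = 0 -> x = y.
Proof.
move=> xy0; apply: (metric_positivity rho_metric).
by rewrite -sqr_snow xy0 expr0n.
Qed.

Lemma snow_gt0 x y : x <> y -> 0 < snow x y.
Proof.
by move=> xy; rewrite lt0r snow_ge0 andbT; apply/eqP => /snow_eq0.
Qed.

Lemma snow_lt x y e : 0 < e -> (snow x y < e) = (rho x y < e ^+ 2).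
Proof.
by move=> e0; rewrite -sqr_snow ltr_pXn2r// ?nnegrE ?snow_ge0// ltW.
Qed.

Lemma le_snow x y e : 0 <= e -> (snow x y <= e) = (rho x y <= e ^+ 2).
Proof.
by move=> e0; rewrite -sqr_snow ler_pXn2r// ?nnegrE ?snow_ge0.
Qed.

(** If [0 <= c <= b] then [b^2 + c^2 <= (b + c / 2)^2]. *)
Lemma snow_slack x y z :
  snow x z <= snow x y + snow y z - Num.min (snow x y) (snow y z) / 2.
Proof.
have := metric_triangular rho_metric x y z; rewrite -!sqr_snow.
have := snow_ge0 x y; have := snow_ge0 y z; have := snow_ge0 x z.
set a := snow x z; set b := snow x y; set c := snow y z => a0 c0 b0.
rewrite !expr2 => tri; case: (leP b c) => bc; rewrite leNgt; apply/negP => lt_a; nra.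
Qed.

Lemma pair_rho_ge0 P Q : 0 <= pair_rho P Q.
Proof. by rewrite addr_ge0// metric_ge0. Qed.

Lemma pair_snow_ge0 P Q : 0 <= pair_snow P Q.
Proof. by rewrite addr_ge0// snow_ge0. Qed.

Lemma pair_rhoC P Q : pair_rho P Q = pair_rho Q P.
Proof.
by rewrite /pair_rho !(metric_symmetric rho_metric Q.1,
  metric_symmetric rho_metric Q.2).
Qed.

Lemma pair_rho_refl P : pair_rho P P = 0.
Proof. by rewrite /pair_rho !(metric_refl rho_metric) addr0. Qed.

Lemma pair_rho_triangular P Q S : pair_rho P S <= pair_rho P Q + pair_rho Q S.
Proof.
rewrite /pair_rho; have := metric_triangular rho_metric P.1 Q.1 S.1.
have := metric_triangular rho_metric P.2 Q.2 S.2; lra.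
Qed.

Lemma pair_rho_le P Q : pair_rho P Q <= pair_snow P Q ^+ 2.
Proof.
rewrite /pair_rho /pair_snow -!sqr_snow.
have := snow_ge0 P.1 Q.1; have := snow_ge0 P.2 Q.2; rewrite !expr2; nra.
Qed.

Lemma pair_snow_le P Q : pair_snow P Q ^+ 2 <= 2 * pair_rho P Q.
Proof.
rewrite /pair_rho /pair_snow -!sqr_snow.
set a := snow _ _; set b := snow _ _; rewrite !expr2.
have := sqr_ge0 (a - b); rewrite expr2; nra.
Qed.

Lemma pair_snow_small P (e : R) : 0 < e ->
  exists2 del, 0 < del & forall Q, pair_rho P Q < del -> pair_snow P Q < e.
Proof.
move=> e0; exists (e ^+ 2 / 2); first by rewrite divr_gt0// exprn_gt0.
move=> Q lt_Q; rewrite -(@ltr_pXn2r _ 2)// ?nnegrE ?pair_snow_ge0//; last exact: ltW.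
by apply: le_lt_trans (pair_snow_le P Q) _; lra.
Qed.

Lemma snow_Metr_c : Metr_c rho -> Metr_c snow.
Proof.
move=> [_ rt rp]; split.
- split; [exact: snow_refl|exact: snow_eq0|exact: snowC|].
  move=> x y z; have := snow_slack x y z.
  have : 0 <= Num.min (snow x y) (snow y z) by rewrite le_min !snow_ge0.
  lra.
- apply/induces_topologyP => x U; split.
    move=> /(nbhs_metricP rt)[e e0 eU]; exists (Num.sqrt e); first by rewrite sqrtr_gt0.
    by move=> y; rewrite snow_lt ?sqrtr_gt0// sqr_sqrtr; [exact: eU|exact: ltW].
  move=> [e e0 eU]; apply/(nbhs_metricP rt); exists (e ^+ 2); first exact: exprn_gt0.
  by move=> y; rewrite -snow_lt//; exact: eU.
- move=> x r; have [r0|r0] := leP 0 r.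
    rewrite (_ : [set y | _] = [set y | rho x y <= r ^+ 2])//.
    by apply/seteqP; split=> y /=; rewrite le_snow.
  rewrite (_ : [set y | _] = set0); first exact: compact0.
  by apply/seteqP; split=> y //= le_r; have := snow_ge0 x y; lra.
Qed.

(** The local Lipschitz constant of [F] at [P] is at most [L].  Nearness is expressed
    by [pair_rho] because this is what symmetries of pairs preserve. *)
Definition slope_le (F : X * X -> R) (P : X * X) (L : R) : Prop :=
  forall eta, 0 < eta -> exists2 del, 0 < del &
    forall Q, pair_rho P Q < del -> `|F Q - F P| <= (L + eta) * pair_snow P Q.

Lemma slope_leD F1 F2 P L1 L2 : slope_le F1 P L1 -> slope_le F2 P L2 ->
  slope_le (fun Q => F1 Q + F2 Q) P (L1 + L2).
Proof.
move=> sl1 sl2 eta eta0; have eta2 : 0 < eta / 2 by lra.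
have [d1 d10 H1] := sl1 _ eta2; have [d2 d20 H2] := sl2 _ eta2.
exists (Num.min d1 d2); first by rewrite lt_min d10.
move=> Q; rewrite lt_min => /andP[/H1 h1 /H2 h2].
have -> : F1 Q + F2 Q - (F1 P + F2 P) = (F1 Q - F1 P) + (F2 Q - F2 P) by lra.
apply: le_trans (ler_normD _ _) _; nra.
Qed.

Lemma slope_le_scale F P c L : 0 <= c -> slope_le F P L ->
  slope_le (fun Q => c * F Q) P (c * L).
Proof.
move=> c0 sl eta eta0.
have c1 : 0 < c + 1 by lra.
have [del del0 H] := sl (eta / (c + 1)) (divr_gt0 eta0 c1).
exists del => // Q /H le1; rewrite -mulrBr normrM ger0_norm//.
apply: le_trans (ler_wpM2l c0 le1) _; rewrite mulrA.
apply: ler_wpM2r; first exact: pair_snow_ge0.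
rewrite mulrDr lerD2l mulrCA ler_piMr//; first exact: ltW.
by rewrite ler_pdivrMr//; lra.
Qed.

Lemma slope_le_lipschitz F P L :
  (forall Q, `|F Q - F P| <= L * pair_snow P Q) -> slope_le F P L.
Proof.
move=> lip eta eta0; exists 1 => // Q _; apply: le_trans (lip Q) _.
by have := pair_snow_ge0 P Q; nra.
Qed.

(** The square root is differentiable at a positive value, and [pair_rho] is
    negligible with respect to [pair_snow]. *)
Lemma slope_le_sqrt N P : (forall Q, 0 <= N Q) ->
  (forall Q, `|N Q - N P| <= pair_rho P Q) -> 0 < N P ->
  slope_le (fun Q => Num.sqrt (N Q)) P 0.
Proof.
move=> N0 Nlip NP eta eta0; rewrite add0r.
have s0 : 0 < Num.sqrt (N P) by rewrite sqrtr_gt0.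
have [del del0 H] := pair_snow_small P (mulr_gt0 eta0 s0).
exists del => // Q /H lt_e.
have sN : `|Num.sqrt (N Q) - Num.sqrt (N P)| * Num.sqrt (N P) <= `|N Q - N P|.
  rewrite -[in leRHS](sqr_sqrtr (N0 Q)) -[in leRHS](sqr_sqrtr (N0 P)) subr_sqr.
  rewrite normrM; apply: ler_wpM2l => //.
  by rewrite ger0_norm ?addr_ge0 ?sqrtr_ge0// lerDr sqrtr_ge0.
have e0 := pair_snow_ge0 P Q.
have le2 : `|N Q - N P| <= pair_snow P Q * (eta * Num.sqrt (N P)).
  apply: le_trans (Nlip Q) _; apply: le_trans (pair_rho_le P Q) _.
  by rewrite expr2; apply: ler_wpM2l => //; exact: ltW.
rewrite -(ler_pM2r s0); apply: le_trans sN _; apply: le_trans le2 _.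
by rewrite mulrCA mulrA.
Qed.

Lemma slope_le_cap F P L s : slope_le F P L ->
  slope_le (fun Q => cap s (F Q)) P L.
Proof.
move=> sl eta eta0; have [del del0 H] := sl eta eta0.
by exists del => // Q /H; apply: le_trans; exact: cap_lipschitz.
Qed.

Lemma snow_slope P : P.1 <> P.2 -> slope_le (fun Q => snow Q.1 Q.2) P 0.
Proof.
move=> P12; apply: slope_le_sqrt => [Q|Q|]; first exact: metric_ge0.
  have h1 := metric_distB rho_metric P.1 Q.1 Q.2.
  have := metric_triangular rho_metric P.1 Q.1 Q.2.
  have := metric_triangular rho_metric P.1 P.2 Q.2.
  have := metric_triangular rho_metric Q.1 P.1 P.2.
  have := metric_triangular rho_metric Q.1 P.1 Q.2.
  have := metric_triangular rho_metric P.1 Q.2 P.2.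
  have := metric_triangular rho_metric P.1 Q.1 P.2.
  have := metric_triangular rho_metric Q.1 Q.2 P.2.
  rewrite (metric_symmetric rho_metric Q.1 P.1) (metric_symmetric rho_metric Q.2 P.2).
  rewrite /pair_rho => *; rewrite ler_norml; apply/andP; split; lra.
by rewrite -sqr_snow exprn_gt0// snow_gt0.
Qed.

End Snowflake.

(** * Bumps at a class of pairs *)

Section PairClasses.
Variables (R : realType) (X : topologicalType) (rho : X -> X -> R).
Variable cls : X * X -> X * X -> Prop.

Let pairX := (X * X)%type.

(** The distance from [Q] to the class of [P]. *)
Definition gap (P Q : pairX) : R :=
  inf [set pair_rho rho Q Q' | Q' in [set Q' | cls P Q']].

(** The distance from [Q] to the class of [P]. *)
Definition gap_bump (s : R) (P Q : pairX) : R := cap s (Num.sqrt (gap P Q)).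

Definition bump_series (a s : nat -> R) (P : nat -> pairX) (Q : pairX) : R :=
  limn (series (fun n => a n * gap_bump (s n) (P n) Q)).

Hypothesis rho_metric : is_metric rho.
Hypotheses (cls_refl : forall P, cls P P)
  (cls_sym : forall P Q, cls P Q -> cls Q P)
  (cls_trans : forall P Q S, cls P Q -> cls Q S -> cls P S)
  (cls_transport : forall P Q, cls P Q -> forall P',
     exists2 Q', cls P' Q' & pair_rho rho P' P = pair_rho rho Q' Q)
  (cls_dist : forall P Q, cls P Q -> rho P.1 P.2 = rho Q.1 Q.2)
  (cls_closed : forall P Q, (forall e : R, 0 < e ->
     exists2 Q', cls P Q' & pair_rho rho Q Q' < e) -> cls P Q).

Lemma cls_snow P Q : cls P Q -> snow rho P.1 P.2 = snow rho Q.1 Q.2.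
Proof. by move=> /cls_dist; rewrite /snow => ->. Qed.

Let gap_has_inf P Q :
  has_inf [set pair_rho rho Q Q' | Q' in [set Q' | cls P Q']].
Proof.
split; first by exists (pair_rho rho Q P), P.
by exists 0 => _ [Q' _ <-]; exact: pair_rho_ge0.
Qed.

Lemma gap_ge0 P Q : 0 <= gap P Q.
Proof.
apply: lb_le_inf (proj1 (gap_has_inf P Q)) _ => _ [Q' _ <-].
exact: pair_rho_ge0.
Qed.

Lemma gap_le P Q Q' : cls P Q' -> gap P Q <= pair_rho rho Q Q'.
Proof. by move=> PQ'; apply: (ge_inf (proj2 (gap_has_inf P Q))); exists Q'. Qed.

Lemma gap_lt P Q e : gap P Q < e ->
  exists2 Q', cls P Q' & pair_rho rho Q Q' < e.
Proof.
move=> lt_e; have e0 : 0 < e - gap P Q by rewrite subr_gt0.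
have [_ [Q' PQ' <-]] := inf_adherent e0 (gap_has_inf P Q).
by rewrite addrC subrK => ?; exists Q'.
Qed.

Lemma gap_dist P Q S : gap P S <= gap P Q + pair_rho rho Q S.
Proof.
apply/ler_addgt0Pr => e e0.
have [|Q' PQ' lt_e] := @gap_lt P Q (gap P Q + e); first by lra.
have := gap_le S PQ'; have := pair_rho_triangular rho_metric S Q Q'.
rewrite (pair_rhoC rho_metric S Q); lra.
Qed.

Lemma gap_lipschitz P Q S : `|gap P S - gap P Q| <= pair_rho rho Q S.
Proof.
have := gap_dist P Q S; have := gap_dist P S Q.
rewrite (pair_rhoC rho_metric S Q) => *.
by rewrite ler_norml; apply/andP; split; lra.
Qed.

Lemma gap_cls P Q S : cls Q S -> gap P Q = gap P S.
Proof.
have le Q1 S1 : cls Q1 S1 -> gap P S1 <= gap P Q1.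
  move=> QS; apply: lb_le_inf (proj1 (gap_has_inf P Q1)) _ => _ [Q' /= PQ' <-].
  have [S' QS' eq_rho] := cls_transport QS Q'.
  rewrite (pair_rhoC rho_metric) eq_rho (pair_rhoC rho_metric).
  by apply: gap_le; exact: cls_trans QS'.
by move=> QS; apply/eqP; rewrite eq_le !le//; exact: cls_sym.
Qed.

Lemma gap_eq0 P Q : cls P Q -> gap P Q = 0.
Proof.
move=> PQ; apply/eqP; rewrite eq_le gap_ge0 andbT.
by rewrite -(pair_rho_refl rho_metric Q); exact: gap_le.
Qed.

Lemma gap_gt0 P Q : ~ cls P Q -> 0 < gap P Q.
Proof.
move=> nPQ; rewrite lt0r gap_ge0 andbT; apply/eqP => g0; apply: nPQ.
by apply: cls_closed => e e0; apply: gap_lt; rewrite g0.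
Qed.

Lemma gap_bump_ge0 s P Q : 0 <= gap_bump s P Q.
Proof. exact: cap_ge0. Qed.

Lemma gap_bump_le s P Q : 0 <= s -> gap_bump s P Q <= s.
Proof. by move=> s0; rewrite cap_le ?sqrtr_ge0. Qed.

Lemma sqrt_gap_lipschitz P Q S :
  `|Num.sqrt (gap P S) - Num.sqrt (gap P Q)| <= pair_snow rho Q S.
Proof.
have sub Q1 S1 : Num.sqrt (gap P S1) <= Num.sqrt (gap P Q1) + pair_snow rho Q1 S1.
  rewrite -(@ler_pXn2r _ 2)// ?nnegrE ?addr_ge0 ?sqrtr_ge0 ?pair_snow_ge0//.
  rewrite sqr_sqrtr ?gap_ge0// sqrrD sqr_sqrtr ?gap_ge0//.
  have := gap_dist P Q1 S1; have := pair_rho_le rho_metric Q1 S1.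
  have : 0 <= Num.sqrt (gap P Q1) * pair_snow rho Q1 S1.
    by rewrite mulr_ge0 ?sqrtr_ge0 ?pair_snow_ge0.
  lra.
have := sub Q S; have := sub S Q.
have -> : pair_snow rho S Q = pair_snow rho Q S.
  by rewrite /pair_snow !(snowC rho_metric S.1, snowC rho_metric S.2).
by move=> *; rewrite ler_norml; apply/andP; split; lra.
Qed.

Lemma gap_bump_lipschitz s P Q S :
  `|gap_bump s P S - gap_bump s P Q| <= pair_snow rho Q S.
Proof. exact: le_trans (cap_lipschitz _ _ _) (sqrt_gap_lipschitz _ _ _). Qed.

Lemma gap_bump_cls s P Q S : cls Q S -> gap_bump s P Q = gap_bump s P S.
Proof. by move=> QS; rewrite /gap_bump (gap_cls P QS). Qed.

Lemma gap_bump_eq0 s P Q : s <= Num.sqrt (gap P Q) -> gap_bump s P Q = 0.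
Proof. by move=> le_s; apply/max_idPl; rewrite subr_le0. Qed.

Lemma gap_bump_center s P Q : 0 <= s -> cls P Q -> gap_bump s P Q = s.
Proof.
by move=> s0 PQ; rewrite /gap_bump gap_eq0// sqrtr0 /cap subr0; apply/max_idPr.
Qed.

(** The two points of any pair in the class of [P] have distance [rho P.1 P.2], and
    their distances to [x] add up to at least that. *)
Lemma snow_le_sqrt_gap P x : snow rho P.1 P.2 <= Num.sqrt (gap P (x, x)).
Proof.
apply: ler_wsqrtr; apply: lb_le_inf (proj1 (gap_has_inf _ _)) _ => _ [Q' PQ' <-].
rewrite (cls_dist PQ') /pair_rho /= (metric_symmetric rho_metric x Q'.1).
exact: metric_triangular.
Qed.

Lemma gap_bump_diag s P x : s <= snow rho P.1 P.2 -> gap_bump s P (x, x) = 0.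
Proof.
by move=> sP; apply: gap_bump_eq0; exact: le_trans (snow_le_sqrt_gap P x).
Qed.

Lemma gap_bump_slope s P Q : ~ cls P Q ->
  slope_le rho (gap_bump s P) Q 0.
Proof.
move=> nPQ; apply: slope_le_cap; apply: slope_le_sqrt => //.
- by move=> S; exact: gap_ge0.
- by move=> S; exact: gap_lipschitz.
- exact: gap_gt0.
Qed.

(** At a class without interior the bump has a positive slope: take a pair [S0] near
    [Q] outside the class and an almost nearest pair [Q'] of the class; a symmetry
    moves [Q'] to [Q]. *)
Lemma gap_bump_drop s P Q del : 0 < s -> 0 < del -> cls P Q ->
  (forall e, 0 < e -> exists2 S, pair_rho rho S Q < e & ~ cls Q S) ->
  exists S, [/\ pair_rho rho Q S < del, 0 < pair_snow rho Q S &
    pair_snow rho Q S / 2 <= gap_bump s P Q - gap_bump s P S].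
Proof.
move=> s0 del0 PQ nonopen.
have e0 : 0 < Num.min (del / 2) (s ^+ 2).
  by rewrite lt_min exprn_gt0// andbT; lra.
have [S0 S0Q nQS0] := nonopen _ e0.
have gap0 : 0 < gap P S0.
  by apply: gap_gt0 => PS0; apply: nQS0; exact: cls_trans (cls_sym PQ) PS0.
have gap_small : gap P S0 < Num.min (del / 2) (s ^+ 2).
  exact: le_lt_trans (gap_le S0 PQ) S0Q.
have [|Q' PQ' lt2] := @gap_lt P S0 (2 * gap P S0); first by lra.
have Q'Q : cls Q' Q by exact: cls_trans (cls_sym PQ') PQ.
(* Moving [Q'] to [Q] turns [S0] into a pair [S] to which [Q] is almost nearest. *)
have [S S0S eq_rho] := cls_transport Q'Q S0.
have eq_gap : gap P S0 = gap P S by exact: gap_cls.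
rewrite eq_rho eq_gap in lt2; rewrite eq_gap in gap0 gap_small.
move: gap_small; rewrite lt_min => /andP[gap_del gap_s].
have rho_lt : pair_rho rho Q S < 2 * gap P S by rewrite (pair_rhoC rho_metric).
have sqrt_s : Num.sqrt (gap P S) <= s.
  rewrite -(@ler_pXn2r _ 2)// ?nnegrE ?sqrtr_ge0//; last exact: ltW.
  by rewrite sqr_sqrtr ?gap_ge0// ltW.
have snow_half : pair_snow rho Q S / 2 <= Num.sqrt (gap P S).
  rewrite -(@ler_pXn2r _ 2)// ?nnegrE ?sqrtr_ge0 ?divr_ge0 ?pair_snow_ge0//.
  rewrite sqr_sqrtr ?gap_ge0// expr_div_n.
  have := pair_snow_le rho_metric Q S; rewrite [2 ^+ 2]expr2; lra.
exists S; split; first by lra.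
- have : 0 < pair_rho rho Q S.
    by apply: lt_le_trans gap0 _; rewrite (pair_rhoC rho_metric); exact: gap_le.
  move=> rho0; rewrite lt0r pair_snow_ge0 andbT; apply/eqP => snow0.
  by have := pair_rho_le rho_metric Q S; rewrite snow0 expr0n /=; lra.
- rewrite (gap_bump_center (ltW s0) PQ).
  suff -> : gap_bump s P S = s - Num.sqrt (gap P S) by lra.
  by apply/max_idPr; rewrite subr_ge0.
Qed.

Section Series.
Variables (a s : nat -> R) (P : nat -> pairX).
Hypothesis a_octal : forall n, 0 <= a n <= octal R n.
Hypothesis s01 : forall n, 0 < s n <= 1.
Hypothesis s_snow : forall n, a n != 0 -> s n <= snow rho (P n).1 (P n).2.

Let U := bump_series a s P.

Lemma bump_series_term Q n :
  0 <= a n * gap_bump (s n) (P n) Q <= octal R n.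
Proof.
have /andP[a0 a1] := a_octal n; have /andP[s0 s1] := s01 n.
have := gap_bump_ge0 (s n) (P n) Q; have := gap_bump_le (P n) Q (ltW s0).
move=> h1 h0; rewrite mulr_ge0//=.
apply: le_trans a1; rewrite -[leRHS]mulr1; apply: ler_wpM2l => //.
exact: le_trans s1.
Qed.

Lemma bump_series_ge0 Q : 0 <= U Q.
Proof. exact: series_octal_ge0 (bump_series_term Q). Qed.

Lemma bump_series_cls Q S : cls Q S -> U Q = U S.
Proof.
move=> QS; congr (limn (series _)); apply/funext => n.
by rewrite (gap_bump_cls _ _ QS).
Qed.

Lemma bump_series_diag x : U (x, x) = 0.
Proof.
apply: series0 => n; have [->|an] := eqVneq (a n) 0; first by rewrite mul0r.
by rewrite gap_bump_diag ?mulr0//; exact: s_snow.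
Qed.

Lemma bump_series_partial Q S m N :
  `|\sum_(m <= i < N) (a i * gap_bump (s i) (P i) S - a i * gap_bump (s i) (P i) Q)|
  <= (\sum_(m <= i < N) octal R i) * pair_snow rho Q S.
Proof.
apply: le_trans (ler_norm_sum _ _ _) _; rewrite mulr_suml; apply: ler_sum => i _.
have /andP[a0 a1] := a_octal i.
rewrite -mulrBr normrM ger0_norm//; apply: ler_pM => //.
exact: gap_bump_lipschitz.
Qed.

Lemma bump_series_lipschitz Q S : `|U S - U Q| <= 1/4 * pair_snow rho Q S.
Proof.
apply: (@series_octal_dist _ _ _ 0%N); do 1?exact: bump_series_term.
move=> N _.
rewrite -(big_mkord xpredT
  (fun i => a i * gap_bump (s i) (P i) S - a i * gap_bump (s i) (P i) Q)).
apply: le_trans (bump_series_partial _ _ _ _) _.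
apply: ler_wpM2r; first exact: pair_snow_ge0.
by rewrite big_mkord sum_octal0.
Qed.

(** The tail of the series has a small Lipschitz constant, and each of the other
    terms has slope 0 off its class. *)
Lemma bump_series_slope Q : (forall n, a n != 0 -> ~ cls (P n) Q) ->
  slope_le rho U Q 0.
Proof.
move=> nPQ eta eta0; rewrite add0r.
have eta4 : 0 < eta / 4 by lra.
have [m small_m] := octal_small eta4.
have : slope_le rho (fun S => \sum_(0 <= i < m) a i * gap_bump (s i) (P i) S) Q 0.
  elim: m {small_m} => [|m IH].
    apply: slope_le_lipschitz => S; rewrite !big_geq// subrr normr0.
    by rewrite mul0r.
  have -> : (fun S => \sum_(0 <= i < m.+1) a i * gap_bump (s i) (P i) S) =
     (fun S => \sum_(0 <= i < m) a i * gap_bump (s i) (P i) S +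
       a m * gap_bump (s m) (P m) S).
    by apply/funext => S; rewrite big_nat_recr.
  rewrite -[X in slope_le _ _ _ X](addr0 0); apply: slope_leD IH _.
  have [->|am] := eqVneq (a m) 0.
    by apply: slope_le_lipschitz => S; rewrite !mul0r subrr normr0.
  rewrite -(mulr0 (a m)); apply: slope_le_scale.
    by have /andP[] := a_octal m.
  exact: gap_bump_slope (nPQ m am).
have eta2 : 0 < eta / 2 by lra.
move=> /(_ _ eta2) [del del0 H]; exists del => // S /H.
rewrite add0r -sumrB => le_fin.
apply: (@series_octal_dist _ _ _ m); do 1?exact: bump_series_term.
move=> N mN.
rewrite -(big_mkord xpredT
  (fun i => a i * gap_bump (s i) (P i) S - a i * gap_bump (s i) (P i) Q)).
rewrite (big_cat_nat (n := m))//=.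
apply: le_trans (ler_normD _ _) _.
have := bump_series_partial Q S m N; have := sum_octal R mN.
have := pair_snow_ge0 rho Q S.
move: le_fin; set A := `|_|; set B := `|_|; set e := pair_snow _ _ _.
set T := \sum_(m <= i < N) _; nra.
Qed.

End Series.

End PairClasses.

(** * Auxiliary choices *)

Section DistinctShifts.
Variable R : realType.

Lemma interval_avoid (s : seq R) (a b : R) : a < b ->
  exists2 y, a <= y <= b & y \notin s.
Proof.
elim: s a b => [|z s IH] a b ab; first by exists a => //; rewrite lexx ltW.
have [zm|mz] := leP z ((a + b) / 2).
  have [|y /andP[y1 y2] ys] := IH (((a + b) / 2 + b) / 2) b; first by lra.
  exists y; first by apply/andP; split; lra.
  by rewrite inE negb_or ys andbT; apply/eqP => yz; move: y1; rewrite yz; lra.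
have [|y /andP[y1 y2] ys] := IH a ((a + b) / 2); first by lra.
exists y; first by apply/andP; split; lra.
by rewrite inE negb_or ys andbT; apply/eqP => yz; move: y2; rewrite yz; lra.
Qed.

(** Each shift is chosen so as to avoid the finitely many values taken before. *)
Lemma distinct_shifts (v beta : nat -> R) : (forall n, 0 < beta n) ->
  exists x : nat -> R, (forall n, 0 <= x n <= beta n) /\
    injective (fun n => v n + x n).
Proof.
move=> beta0.
have /choice[y yP] (sn : seq R * nat) : exists y,
    v sn.2 <= y <= v sn.2 + beta sn.2 /\ y \notin sn.1.
  have [|y y1 y2] := @interval_avoid sn.1 (v sn.2) (v sn.2 + beta sn.2).
    by rewrite ltrDl.
  by exists y.
(* [used n] lists the values taken before step [n]. *)
pose fix used n := if n is m.+1 then y (used m, m) :: used m else [::].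
have used_mem m n : (m < n)%N -> y (used m, m) \in used n.
  elim: n => // n IH; rewrite ltnS leq_eqVlt inE => /orP[/eqP ->|/IH ->].
    by rewrite eqxx.
  by rewrite orbT.
have neq m n : (m < n)%N -> y (used m, m) <> y (used n, n).
  move=> mn eq_y; have [_] := yP (used n, n).
  by rewrite /= -eq_y used_mem.
exists (fun n => y (used n, n) - v n); split.
  by move=> n; have [/andP[/= h1 h2] _] := yP (used n, n); apply/andP; split; lra.
move=> m n /=; rewrite !subrKC => eq_y.
by case: (ltngtP m n) => // [/neq|/neq/nesym].
Qed.

End DistinctShifts.

Section FirstRepresentatives.
Variables (T : Type) (E : T -> T -> Prop) (S : set T) (P : nat -> T).

(** Selecting the first representative of each class in a sequence avoids that two
    bumps are placed on one class. *)
Definition first_rep k :=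
  S (P k) /\ forall m, (m < k)%N -> S (P m) -> ~ E (P m) (P k).

Hypotheses (E_refl : forall x, E x x) (E_sym : forall x y, E x y -> E y x)
  (E_trans : forall x y z, E x y -> E y z -> E x z).

Lemma first_rep_exists n : S (P n) -> exists2 k, first_rep k & E (P k) (P n).
Proof.
elim/ltn_ind: n => n IH Sn.
have [[m [mn Sm Em]]|none] :=
  pselect (exists m, [/\ (m < n)%N, S (P m) & E (P m) (P n)]).
  by have [k fk Ek] := IH m mn Sm; exists k => //; exact: E_trans Em.
exists n => //; split=> // m mn Sm Em; apply: none; by exists m.
Qed.

Lemma first_rep_inj k l : first_rep k -> first_rep l -> E (P k) (P l) -> k = l.
Proof.
move=> [Sk fk] [Sl fl] Ekl; case: (ltngtP k l) => // [kl|lk].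
  by case: (fl k kl Sk).
by case: (fk l lk Sl); exact: E_sym.
Qed.

End FirstRepresentatives.

(** * A metric whose isometries preserve the classes of pairs *)

Section Labelling.
Variables (R : realType) (X : topologicalType) (rho : X -> X -> R).

Lemma dense_pair_sequence (c : nat -> X) (S : set (X * X)) :
  is_metric rho -> induces_topology rho ->
  (forall (x : X) U, nbhs x U -> exists n, U (c n)) ->
  exists P : nat -> X * X, forall Q, S Q -> forall e : R, 0 < e ->
    exists2 n, S (P n) & pair_rho rho Q (P n) < e.
Proof.
move=> rm rt c_dense.
(* One pair of [S] is chosen in each product of balls that meets [S]. *)
pose near_pair i j k : set (X * X) := [set Q | [/\ S Q,
  rho (c i) Q.1 < k.+1%:R^-1 & rho (c j) Q.2 < k.+1%:R^-1]].
exists (fun n => if unpickle n is Some (i, j, k)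
  then xget (c 0%N, c 0%N) (near_pair i j k) else (c 0%N, c 0%N)).
move=> Q SQ e e0.
have e4 : 0 < e / 4 by lra.
have [k _ /(_ k (leqnn k)) /= k_lt] := near_infty_natSinv_lt (PosNum e4).
have k0 : 0 < k.+1%:R^-1 :> R by rewrite invr_gt0.
have [i /= iQ] := c_dense Q.1 _ (nbhs_metric_ball rt Q.1 k0).
have [j /= jQ] := c_dense Q.2 _ (nbhs_metric_ball rt Q.2 k0).
have nearQ : near_pair i j k Q.
  by split=> //; rewrite (metric_symmetric rm).
have [P [eqP SP iP jP]] : exists P, [/\ xget (c 0%N, c 0%N) (near_pair i j k) = P,
    S P, rho (c i) P.1 < k.+1%:R^-1 & rho (c j) P.2 < k.+1%:R^-1].
  by case: xgetP => [P _ [SP iP jP]|/(_ Q)//]; exists P.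
exists (pickle (i, j, k)); rewrite pickleK eqP// /pair_rho.
have := metric_triangular rm Q.1 (c i) P.1.
have := metric_triangular rm Q.2 (c j) P.2.
by move: k_lt iP jP iQ jQ; set t := (_^-1); lra.
Qed.

(** Replacing [(x, z)] by the end points of the longer of the sides [x y] and [y z]
    changes [U] by at most half of the shorter side, which is the slack in
    [snow_slack]. *)
Lemma perturbed_Metr_c (U : X * X -> R) : Metr_c rho ->
  (forall Q, 0 <= U Q) -> (forall x, U (x, x) = 0) ->
  (forall x y, U (x, y) = U (y, x)) ->
  (forall Q S, `|U S - U Q| <= 1/2 * pair_snow rho Q S) ->
  Metr_c (fun x y => snow rho x y + U (x, y)) /\
  forall x y, U (x, y) <= snow rho x y.
Proof.
move=> rM U0 Udiag Usym Ulip; have [rm rt rp] := rM.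
have [sm st sp] := snow_Metr_c rm rM.
have lipr x y z : `|U (x, z) - U (x, y)| <= 1/2 * snow rho y z.
  apply: le_trans (Ulip _ _) _; rewrite /pair_snow /= snow_refl// add0r.
  exact: lexx.
have U_le x y : U (x, y) <= 1/2 * snow rho x y.
  have := lipr x x y; rewrite Udiag subr0; apply: le_trans; exact: ler_norm.
have U_le1 x y : U (x, y) <= snow rho x y.
  by have := U_le x y; have := snow_ge0 rho x y; lra.
set d' := fun x y => snow rho x y + U (x, y).
have d'm : is_metric d'.
  split.
  + by move=> x; rewrite /d' Udiag snow_refl// addr0.
  + rewrite /d' => x y xy0; apply: (metric_positivity sm).
    by have := U0 (x, y); have := snow_ge0 rho x y; lra.
  + by move=> x y; rewrite /d' snowC// Usym.
  + move=> x y z; rewrite /d'; have := snow_slack rm x y z.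
    have h1 := lipr x y z; have h2 := lipr z y x.
    rewrite (snowC rm y x) in h2.
    rewrite (Usym z x) (Usym z y) in h2.
    move: h1 h2; rewrite !ler_norml => /andP[_ h1] /andP[_ h2].
    have := U0 (x, y); have := U0 (y, z).
    by case: (leP (snow rho x y) (snow rho y z)) => _; lra.
have d't : induces_topology d'.
  apply/induces_topologyP => x V; split.
    move=> /(nbhs_metricP st)[e e0 eV]; exists e => // y lt_e; apply: eV.
    move: lt_e; rewrite /d'; have := U0 (x, y); lra.
  move=> [e e0 eV]; apply/(nbhs_metricP st); exists (e / 2); first by lra.
  by move=> y lt_e; apply: eV; rewrite /d'; have := U_le1 x y; lra.
split=> //; split=> // x r; apply: (metric_closed_ball_compact d'm d't).
exists [set y | snow rho x y <= r]; first exact: sp.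
by move=> y /=; rewrite /d'; have := U0 (x, y); lra.
Qed.

End Labelling.

Section PairClassMetric.
Variables (R : realType) (X : topologicalType) (rho : X -> X -> R).
Variables (cls : X * X -> X * X -> Prop) (c : nat -> X).

Hypothesis rho_Metr_c : Metr_c rho.
Hypothesis c_dense : forall (x : X) U, nbhs x U -> exists n, U (c n).
Hypotheses (cls_refl : forall P, cls P P)
  (cls_sym : forall P Q, cls P Q -> cls Q P)
  (cls_trans : forall P Q S, cls P Q -> cls Q S -> cls P S)
  (cls_transport : forall P Q, cls P Q -> forall P',
     exists2 Q', cls P' Q' & pair_rho rho P' P = pair_rho rho Q' Q)
  (cls_dist : forall P Q, cls P Q -> rho P.1 P.2 = rho Q.1 Q.2)
  (cls_closed : forall P Q, (forall e : R, 0 < e ->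
     exists2 Q', cls P Q' & pair_rho rho Q Q' < e) -> cls P Q)
  (cls_swap : forall x y, cls (x, y) (y, x)).

Let rho_metric : is_metric rho. Proof. by case: rho_Metr_c. Qed.
Let rho_topology : induces_topology rho. Proof. by case: rho_Metr_c. Qed.

(** On such a class an invariant function is locally constant, so that slopes
    cannot distinguish it from other classes. *)
Definition open_class (P : X * X) : Prop :=
  exists2 del : R, 0 < del & forall Q, pair_rho rho Q P < del -> cls P Q.

Lemma open_class_cls P Q : cls P Q -> open_class P -> open_class Q.
Proof.
move=> PQ [del del0 openP]; exists del => // Q' lt_Q'.
have [S Q'S eq_rho] := cls_transport (cls_sym PQ) Q'.
rewrite eq_rho in lt_Q'.
exact: cls_trans (cls_sym PQ) (cls_trans (openP S lt_Q') (cls_sym Q'S)).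
Qed.

Lemma offdiag_cls P Q : cls P Q -> P.1 <> P.2 -> Q.1 <> Q.2.
Proof.
move=> /cls_dist eq_rho P12 Q12; apply: P12.
by apply: (metric_positivity rho_metric); rewrite eq_rho Q12 (metric_refl rho_metric).
Qed.

Lemma not_open_near P : ~ open_class P ->
  forall e : R, 0 < e -> exists2 S, pair_rho rho S P < e & ~ cls P S.
Proof.
move=> nP e e0; apply: contrapT => none; apply: nP; exists e => // Q lt_e.
by apply: contrapT => nPQ; apply: none; exists Q.
Qed.

Lemma open_class_gap P : open_class P ->
  exists2 r : R, 0 < r & forall Q, ~ cls P Q -> r <= Num.sqrt (gap rho cls P Q).
Proof.
move=> [del del0 openP]; exists (Num.sqrt del); first by rewrite sqrtr_gt0.
move=> Q nPQ; apply: ler_wsqrtr; rewrite leNgt; apply/negP => gap_lt_del.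
have [Q' PQ' lt_del] := gap_lt rho_metric cls_refl gap_lt_del.
(* Openness is assumed at [P] only; the pair near [Q'] is carried near [P]. *)
have [S QS eq_rho] := cls_transport (cls_sym PQ') Q.
rewrite eq_rho in lt_del; apply: nPQ.
exact: cls_trans (openP S lt_del) (cls_sym QS).
Qed.

(** The metric is the function [F] of the proof, the square root of [rho] increased
    by two series of bumps: [UN] gives slopes that identify a dense family of
    classes that are not open, and [UD] gives pairwise distinct values to the open
    ones. *)
Theorem pair_class_metric : exists d : X -> X -> R, [/\ Metr_c d,
  forall P Q, cls P Q -> d P.1 P.2 = d Q.1 Q.2 &
  forall f g, cancel f g -> cancel g f ->
    (forall x y, d (f x) (f y) = d x y) ->
    forall x y, x <> y -> cls (x, y) (f x, f y)].
Proof.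
(* [SN] and [SD] are the pairs to be recognised by slopes and by values. *)
pose SN := [set P : X * X | P.1 <> P.2 /\ ~ open_class P].
pose SD := [set P : X * X | P.1 <> P.2 /\ open_class P].
have SN_cls P Q : cls P Q -> SN P -> SN Q.
  move=> PQ [P12 nP]; split; first exact: offdiag_cls P12.
  by move=> oQ; apply: nP; exact: open_class_cls (cls_sym PQ) oQ.
have [PN PN_dense] := dense_pair_sequence SN rho_metric rho_topology c_dense.
have [PD PD_dense] := dense_pair_sequence SD rho_metric rho_topology c_dense.
pose fN := first_rep cls SN PN; pose fD := first_rep cls SD PD.
pose a k : R := if `[< fN k >] then octal R k else 0.
pose sN k : R := if `[< fN k >] then Num.min 1 (snow rho (PN k).1 (PN k).2) else 1.
have a_octal k : 0 <= a k <= octal R k.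
  by rewrite /a; case: ifP => _; rewrite lexx ltW// octal_gt0.
have a_neq0 k : a k != 0 -> fN k.
  by rewrite /a; case: asboolP => //; rewrite eqxx.
have sN01 k : 0 < sN k <= 1.
  rewrite /sN; case: asboolP => [[[P12 _] _]|_]; last by rewrite ltr01 lexx.
  by rewrite ge_min lexx lt_min ltr01 /= snow_gt0.
have sN_snow k : a k != 0 -> sN k <= snow rho (PN k).1 (PN k).2.
  by move=> /a_neq0 fk; rewrite /sN; case: asboolP => // _; rewrite ge_min lexx orbT.
pose UN := bump_series rho cls a sN PN.
(* The radius [sD k] isolates the open class [k], so that the bump placed there
   vanishes on all other classes. *)
have /choice[sD sDP] k : exists s : R, 0 < s <= 1 /\
    (fD k -> s <= snow rho (PD k).1 (PD k).2 /\
      forall Q, ~ cls (PD k) Q -> s <= Num.sqrt (gap rho cls (PD k) Q)).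
  have [fk|nfk] := pselect (fD k); last by exists 1; rewrite ltr01 lexx.
  have [[P12 oP] _] := fk; have [r r0 r_gap] := open_class_gap oP.
  exists (Num.min (Num.min 1 (snow rho (PD k).1 (PD k).2)) r).
  rewrite !lt_min !ge_min !lexx ltr01 r0 snow_gt0// orbT /=.
  by split=> // _; split=> // Q /r_gap; rewrite ge_min => ->; rewrite orbT.
have sD01 k : 0 < sD k <= 1 by have [] := sDP k.
have sD0 k : 0 < sD k by have /andP[] := sD01 k.
pose v k := snow rho (PD k).1 (PD k).2 + UN (PD k).
have beta0 k : 0 < octal R k * sD k by rewrite mulr_gt0// octal_gt0.
(* [v k] is the value on the open class [k] before the bump there is added. *)
have [x [x_bounds x_inj]] := distinct_shifts v beta0.
pose b k : R := if `[< fD k >] then x k / sD k else 0.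
have b_octal k : 0 <= b k <= octal R k.
  rewrite /b; case: ifP => _; last by rewrite lexx ltW// octal_gt0.
  have /andP[x0 x1] := x_bounds k.
  by rewrite divr_ge0//= ?ler_pdivrMr// ltW.
have b_neq0 k : b k != 0 -> fD k.
  by rewrite /b; case: asboolP => //; rewrite eqxx.
have sD_snow k : b k != 0 -> sD k <= snow rho (PD k).1 (PD k).2.
  by move=> /b_neq0 fk; have [_ /(_ fk)[]] := sDP k.
pose UD := bump_series rho cls b sD PD.
pose F Q := snow rho Q.1 Q.2 + (UN Q + UD Q).
have UN_cls P Q : cls P Q -> UN P = UN Q by exact: bump_series_cls.
have UD_cls P Q : cls P Q -> UD P = UD Q by exact: bump_series_cls.
have F_cls P Q : cls P Q -> F P = F Q.
  by move=> PQ; rewrite /F (UN_cls _ _ PQ) (UD_cls _ _ PQ) (cls_snow cls_dist PQ).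
have [d_Metr_c U_le] : Metr_c (fun x y => snow rho x y + (UN (x, y) + UD (x, y))) /\
    forall x y, UN (x, y) + UD (x, y) <= snow rho x y.
  apply: (@perturbed_Metr_c _ _ _ (fun Q => UN Q + UD Q)) => //.
  - by move=> Q; rewrite addr_ge0//; apply: bump_series_ge0.
  - move=> y; rewrite /UN /UD !bump_series_diag ?addr0//.
  - by move=> y z; rewrite (UN_cls _ _ (cls_swap y z)) (UD_cls _ _ (cls_swap y z)).
  - move=> Q S.
    have -> : UN S + UD S - (UN Q + UD Q) = (UN S - UN Q) + (UD S - UD Q) by lra.
    apply: le_trans (ler_normD _ _) _.
    have hN : `|UN S - UN Q| <= 1/4 * pair_snow rho Q S by exact: bump_series_lipschitz.
    have hD : `|UD S - UD Q| <= 1/4 * pair_snow rho Q S by exact: bump_series_lipschitz.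
    lra.
exists (fun y z => F (y, z)); split; first exact: d_Metr_c.
  by move=> [p1 p2] [q1 q2]; exact: F_cls.
(* On an open class only its own bump in [UD] is nonzero, by the choice of [sD]. *)
have F_open P k : fD k -> cls (PD k) P -> F P = v k + x k.
  move=> fk PP; rewrite /F -(cls_snow cls_dist PP) -(UN_cls _ _ PP) addrA.
  congr (_ + _); rewrite /UD /bump_series (series_octal_single k); last first.
    by move=> n; exact: bump_series_term.
  rewrite gap_bump_center//; last exact: ltW.
  rewrite series0 ?addr0.
    by rewrite /b asboolT// divfK// gt_eqF.
  move=> n; case: eqP => // nk; have [->|bn] := eqVneq (b n) 0.
    by rewrite mul0r.
  rewrite gap_bump_eq0 ?mulr0//; have fn := b_neq0 n bn.
  have [_ /(_ fn)[_ sgap]] := sDP n; apply: sgap => PnP; apply: nk.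
  by apply: (first_rep_inj cls_sym fn fk); exact: cls_trans PnP (cls_sym PP).
have open_same P Q : SD P -> SD Q -> F P = F Q -> cls P Q.
  have cover S : SD S -> exists2 k, fD k & cls (PD k) S.
    move=> SDS; have [del del0 openS] := proj2 SDS.
    have [n SDn lt_n] := PD_dense S SDS del del0.
    have [k fk ck] := first_rep_exists cls_refl cls_trans SDn.
    exists k => //; apply: cls_trans ck _; apply: cls_sym; apply: openS.
    by rewrite pair_rhoC.
  move=> /cover[k fk kP] /cover[l fl lQ].
  rewrite (F_open P k)// (F_open Q l)// => /x_inj kl.
  by rewrite -kl in lQ; exact: cls_trans (cls_sym kP) lQ.
have UD_slope P : ~ open_class P -> slope_le rho UD P 0.
  move=> nP; apply: bump_series_slope => // n /b_neq0 [[_ oPn] _] PnP.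
  by apply: nP; exact: open_class_cls PnP oPn.
(* On an open class [F] is locally constant; elsewhere each of the three terms
   has slope 0. *)
have F_flat P : P.1 <> P.2 -> (forall k, fN k -> ~ cls (PN k) P) ->
    slope_le rho F P 0.
  move=> P12 unlabelled; have [oP|nP] := pselect (open_class P).
    have [del del0 openP] := oP; move=> eta eta0; exists del => // Q.
    rewrite pair_rhoC// => /openP PQ; rewrite (F_cls _ _ PQ) subrr normr0.
    by rewrite add0r mulr_ge0 ?pair_snow_ge0// ltW.
  rewrite -[X in slope_le _ _ _ X](addr0 0); apply: slope_leD.
    exact: snow_slope.
  rewrite -[X in slope_le _ _ _ X](addr0 0); apply: slope_leD (UD_slope P nP).
  by apply: bump_series_slope => // n /a_neq0 fn; exact: unlabelled.
(* Near its own class, bump [k] is the only term with a nonzero slope. *)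
have F_split k P : fN k -> cls (PN k) P -> exists2 G, slope_le rho G P 0 &
    forall Q, F Q = octal R k * gap_bump rho cls (sN k) (PN k) Q + G Q.
  move=> fk kP; have [P12 nP] : SN P by apply: SN_cls kP _; case: fk.
  pose a' n := if n == k then 0 else a n.
  exists (fun Q => snow rho Q.1 Q.2 + (bump_series rho cls a' sN PN Q + UD Q)).
    rewrite -[X in slope_le _ _ _ X](addr0 0); apply: slope_leD.
      exact: snow_slope.
    rewrite -[X in slope_le _ _ _ X](addr0 0); apply: slope_leD (UD_slope P nP).
    apply: bump_series_slope => //.
      by move=> n; rewrite /a'; case: eqP => // _; rewrite lexx ltW// octal_gt0.
    move=> n; rewrite /a'; have [_|nk /a_neq0 fn nP'] := eqVneq n k; first by rewrite eqxx.
    move/eqP: nk; apply; apply: (first_rep_inj cls_sym fn fk).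
    exact: cls_trans nP' (cls_sym kP).
  move=> Q; rewrite /F /UN /bump_series (series_octal_single k); last first.
    by move=> n; exact: bump_series_term.
  rewrite {1}/a asboolT//.
  have -> : (fun n => if n == k then 0 else a n * gap_bump rho cls (sN n) (PN n) Q) =
      (fun n => a' n * gap_bump rho cls (sN n) (PN n) Q).
    by apply/funext => n; rewrite /a'; case: eqP => // _; rewrite mul0r.
  lra.
have F_labelled k P : fN k -> cls (PN k) P -> slope_le rho F P (octal R k).
  move=> fk kP; have [G Gflat FG] := F_split k P fk kP.
  have -> : F = (fun Q => octal R k * gap_bump rho cls (sN k) (PN k) Q + G Q).
    by apply/funext.
  rewrite -[X in slope_le _ _ _ X]addr0; apply: slope_leD Gflat.
  rewrite -[X in slope_le _ _ _ X]mulr1; apply: slope_le_scale.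
    exact: ltW (octal_gt0 _ _).
  by apply: slope_le_lipschitz => Q; rewrite mul1r; exact: gap_bump_lipschitz.
have F_drop k P eta del : fN k -> cls (PN k) P -> 0 < eta -> 0 < del ->
    exists S, [/\ pair_rho rho P S < del, 0 < pair_snow rho P S &
      (octal R k / 2 - eta) * pair_snow rho P S <= `|F S - F P|].
  move=> fk kP eta0 del0; have [G Gflat FG] := F_split k P fk kP.
  have [P12 nP] : SN P by apply: SN_cls kP _; case: fk.
  have [del' del'0 HG] := Gflat eta eta0.
  have m0 : 0 < Num.min del del' by rewrite lt_min del0.
  have /andP[sk0 _] := sN01 k.
  have [S []] := gap_bump_drop rho_metric cls_refl cls_sym cls_trans cls_transport
    cls_closed sk0 m0 kP (not_open_near nP).
  rewrite lt_min => /andP[S1 /HG]; rewrite add0r => S2 S3 S4.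
  exists S; split=> //; rewrite !FG distrC.
  apply: le_trans (ler_norm _).
  have := octal_gt0 R k; move: S2; rewrite ler_norml => /andP[_].
  move: S4; set B := gap_bump _ _ _ _ _; set B' := gap_bump _ _ _ _ _.
  set e := pair_snow _ _ _; set o := octal _ _; nra.
move=> f0 g0 fg0 gf0 iso0.
pose f2 (f : X -> X) (P : X * X) := (f P.1, f P.2).
pose iso (f g : X -> X) := [/\ cancel f g, cancel g f &
  forall P, F (f2 f P) = F P].
have iso_f0 : iso f0 g0.
  by split=> // P; rewrite [in RHS](surjective_pairing P) -iso0.
have iso_sym f g : iso f g -> iso g f.
  move=> [fg gf fF]; split=> // P; rewrite -fF /f2 /= !gf.
  by rewrite -surjective_pairing.
have F_bounds P : snow rho P.1 P.2 <= F P <= 2 * snow rho P.1 P.2.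
  have := U_le P.1 P.2; rewrite /F -surjective_pairing => le_U.
  have : 0 <= UN P + UD P by rewrite addr_ge0//; exact: bump_series_ge0.
  by move=> *; apply/andP; split; lra.
have iso_snow f g P Q : iso f g ->
    pair_snow rho (f2 f P) (f2 f Q) <= 2 * pair_snow rho P Q.
  move=> [_ _ fF]; rewrite /pair_snow /=.
  have /andP[h1 _] := F_bounds (f P.1, f Q.1).
  have /andP[h2 _] := F_bounds (f P.2, f Q.2).
  have /andP[_ h3] := F_bounds (P.1, Q.1); have /andP[_ h4] := F_bounds (P.2, Q.2).
  have := fF (P.1, Q.1); have := fF (P.2, Q.2); rewrite /f2 /=.
  move: h1 h2 h3 h4 => /=; lra.
have iso_rho f g P Q : iso f g ->
    pair_rho rho (f2 f P) (f2 f Q) <= 8 * pair_rho rho P Q.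
  move=> isof; have le_s := iso_snow f g P Q isof.
  have := pair_rho_le rho_metric (f2 f P) (f2 f Q).
  have := pair_snow_le rho_metric P Q.
  have := pair_snow_ge0 rho P Q; have := pair_snow_ge0 rho (f2 f P) (f2 f Q).
  move: le_s; rewrite !expr2; nra.
have iso_offdiag f g P : iso f g -> P.1 <> P.2 -> (f2 f P).1 <> (f2 f P).2.
  by move=> [fg _ _] P12 /= /(can_inj fg).
(* The factor 4: a bump drops at half of its slope bound in [gap_bump_drop],
   and an isometry distorts [pair_snow] by a factor at most 2.  It is smaller
   than the ratio 8 of consecutive coefficients. *)
have label_slope f g k P L : 0 <= L -> iso f g -> fN k -> cls (PN k) P ->
    slope_le rho F (f2 f P) L -> octal R k <= 4 * L.
  move=> L0 isof fk kP slopeL.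
  suff : octal R k / 2 <= 2 * L by lra.
  apply/ler_addgt0Pr => e e0; have eta0 : 0 < e / 3 by lra.
  have [del del0 HL] := slopeL _ eta0.
  have del8 : 0 < del / 8 by lra.
  have [S [S1 S2 S3]] := F_drop k P (e / 3) (del / 8) fk kP eta0 del8.
  have near_S : pair_rho rho (f2 f P) (f2 f S) < del.
    by apply: le_lt_trans (iso_rho f g P S isof) _; lra.
  have := HL _ near_S; have [_ _ fF] := isof; rewrite !fF => le_L.
  have le_s := iso_snow f g P S isof.
  have Lpos : 0 < L + e / 3 by lra.
  have le2 : (octal R k / 2 - e / 3) * pair_snow rho P S <=
      (2 * (L + e / 3)) * pair_snow rho P S.
    apply: le_trans S3 _; apply: le_trans le_L _.
    by rewrite -mulrA mulrCA; apply: ler_wpM2l; [exact: ltW|].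
  by move: le2; rewrite ler_pM2r//; lra.
have label_le f g k P : iso f g -> fN k -> cls (PN k) P ->
    exists l, [/\ fN l, cls (PN l) (f2 f P) & (l <= k)%N].
  move=> isof fk kP.
  have P12 : P.1 <> P.2 by have [] : SN P by apply: SN_cls kP _; case: fk.
  have [[l [fl lP]]|none] := pselect (exists l, fN l /\ cls (PN l) (f2 f P)).
    exists l; split=> //; rewrite leqNgt; apply/negP => /(octal_lt R) kl.
    have := label_slope f g k P _ (ltW (octal_gt0 R l)) isof fk kP (F_labelled l _ fl lP).
    by have := octal_gt0 R l; lra.
  have : slope_le rho F (f2 f P) 0.
    apply: F_flat; first exact: iso_offdiag isof P12.
    by move=> l fl lP; apply: none; exists l.
  move=> /(label_slope f g k P _ (lexx 0) isof fk kP).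
  by have := octal_gt0 R k; lra.
have label_eq f g k P : iso f g -> fN k -> cls (PN k) P -> cls P (f2 f P).
  move=> isof fk kP.
  have [l [fl lP lk]] := label_le f g k P isof fk kP.
  have [m [fm mP ml]] := label_le g f l _ (iso_sym _ _ isof) fl lP.
  have gfP : f2 g (f2 f P) = P.
    by have [fg _ _] := isof; rewrite /f2 /= !fg -surjective_pairing.
  rewrite gfP in mP.
  have mk : m = k.
    by apply: (first_rep_inj cls_sym fm fk); exact: cls_trans mP (cls_sym kP).
  have kl : k = l by apply/eqP; rewrite eqn_leq lk -mk ml.
  by rewrite -kl in lP; exact: cls_trans (cls_sym kP) lP.
(* Labelled classes are dense among the classes that are not open, and both
   [f] and the transport along a class are continuous. *)
have not_open_eq f g P : iso f g -> SN P -> cls P (f2 f P).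
  move=> isof SNP; apply: cls_closed => e e0.
  have e9 : 0 < e / 9 by lra.
  have [n SNn lt_n] := PN_dense P SNP _ e9.
  have [k fk kn] := first_rep_exists cls_refl cls_trans SNn.
  have cn := label_eq f g k _ isof fk kn.
  have [S PS eq_rho] := cls_transport cn P.
  exists S => //; rewrite (pair_rhoC rho_metric).
  have := pair_rho_triangular rho_metric S (f2 f (PN n)) (f2 f P).
  rewrite -eq_rho (pair_rhoC rho_metric (f2 f (PN n))).
  have := iso_rho f g P (PN n) isof; lra.
move=> y z yz; change (cls (y, z) (f2 f0 (y, z))).
set P := (y, z).
have fP12 := iso_offdiag f0 g0 P iso_f0 yz.
have [oP|nP] := pselect (open_class P); last exact: not_open_eq iso_f0 _.
(* If the image of an open class is not open, the inverse isometry preserves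
   the class of the image, so this case is covered as well. *)
have [ofP|nfP] := pselect (open_class (f2 f0 P)).
  by apply: open_same => //; have [_ _ ->] := iso_f0.
apply: cls_sym; have := not_open_eq g0 f0 (f2 f0 P) (iso_sym _ _ iso_f0) (conj fP12 nfP).
by rewrite [f2 g0 _]/f2 /= !fg0.
Qed.

End PairClassMetric.

(** * Pairs modulo the group *)

Section PairOrbits.
Variables (G : topologicalGroupType) (X : topologicalType) (act : G -> X -> X).

Definition same_pair (P Q : X * X) : Prop := exists g,
  Q = (act g P.1, act g P.2) \/ Q = (act g P.2, act g P.1).

Hypothesis act_action : is_action act.

Lemma same_pair_refl P : same_pair P P.
Proof.
by exists 1%g; left; rewrite !(proj1 act_action) -surjective_pairing.
Qed.

Lemma same_pair_swap x y : same_pair (x, y) (y, x).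
Proof. by exists 1%g; right; rewrite !(proj1 act_action). Qed.

Lemma same_pair_sym P Q : same_pair P Q -> same_pair Q P.
Proof.
move=> [g [->|->]]; exists g^-1%g; [left|right];
  by rewrite /= !actK// -surjective_pairing.
Qed.

Lemma same_pair_trans P Q S : same_pair P Q -> same_pair Q S -> same_pair P S.
Proof.
move=> [g gPQ] [h hQS]; exists (h * g)%g; rewrite !(proj2 act_action).
by case: gPQ hQS => -> [] ->; [left|right|right|left].
Qed.

Variables (R : realType) (rho : X -> X -> R).
Hypothesis rho_act : forall g x y, rho (act g x) (act g y) = rho x y.

Lemma same_pair_transport P Q : same_pair P Q -> forall P',
  exists2 Q', same_pair P' Q' & pair_rho rho P' P = pair_rho rho Q' Q.
Proof.
move=> [g [->|->]] P'.
  exists (act g P'.1, act g P'.2); first by exists g; left.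
  by rewrite /pair_rho /= !rho_act.
exists (act g P'.2, act g P'.1); first by exists g; right.
by rewrite /pair_rho /= !rho_act addrC.
Qed.

Hypothesis rho_Metr_c : Metr_c rho.

Lemma same_pair_dist P Q : same_pair P Q -> rho P.1 P.2 = rho Q.1 Q.2.
Proof.
have [rm _ _] := rho_Metr_c.
by move=> [g [->|->]] /=; rewrite rho_act// (metric_symmetric rm).
Qed.

Hypotheses (act_continuous : continuous_action act) (act_proper : proper_action act).

(** Only a compact set of group elements moves [P] near [Q], and on it the distance
    from [Q] to the translates of [P] is bounded below by a positive number if
    none of them equals [Q]. *)
Lemma same_pair_closed P Q :
  (forall e : R, 0 < e -> exists2 Q', same_pair P Q' & pair_rho rho Q Q' < e) ->
  same_pair P Q.
Proof.
have [rm rt rp] := rho_Metr_c.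
move=> close_Q; apply: contrapT => nPQ.
pose tr (b : bool) g : X * X :=
  if b then (act g P.1, act g P.2) else (act g P.2, act g P.1).
have tr_neq b g : 0 < pair_rho rho Q (tr b g).
  rewrite lt0r pair_rho_ge0// andbT; apply/eqP => Q0; apply: nPQ; exists g.
  have [Q1 Q2] : Q.1 = (tr b g).1 /\ Q.2 = (tr b g).2.
    move: Q0; rewrite /pair_rho.
    have := metric_ge0 rm Q.1 (tr b g).1; have := metric_ge0 rm Q.2 (tr b g).2.
    by move=> ? ? ?; split; apply: (metric_positivity rm); lra.
  by rewrite (surjective_pairing Q) Q1 Q2; case: b {Q0 Q1 Q2}; [left|right].
have tr_cont b g : pair_rho rho Q (tr b h) @[h --> g] --> pair_rho rho Q (tr b g).
  have cvg_act z y : rho y (act h z) @[h --> g] --> rho y (act g z).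
    apply: continuous_cvg; first exact: metric_continuous rm rt y _.
    by apply: (act_cvg act_continuous); [exact: cvg_id|exact: cvg_cst].
  by case: b; apply: cvgD; exact: cvg_act.
pose far (A : set G) := exists2 e : R, 0 < e &
  forall b h, A h -> e <= pair_rho rho Q (tr b h).
(* An element that moves [P], in either order, to distance at most 1 from [Q]
   moves [P.1] into one of the two unit balls. *)
pose C := [set g | exists2 x, [set P.1] x &
  ([set y | rho Q.1 y <= 1] `|` [set y | rho Q.2 y <= 1]) (act g x)].
have cC : compact C.
  apply: transporter_compact => //; first exact: compact_set1.
  by apply: compactU; exact: rp.
have [e e0 far_e] : far C.
  apply: compact_induction cC _ _ _ _.
  - by exists 1.
  - by move=> A B AB [e e0 He]; exists e => // b h /AB; exact: He.
  - move=> A B [e e0 He] [e' e'0 He']; exists (Num.min e e').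
      by rewrite lt_min e0.
    by move=> b h [/He|/He'] => /(_ b) le_e; rewrite ge_min le_e ?orbT.
  move=> g _.
  pose m := Num.min (pair_rho rho Q (tr true g)) (pair_rho rho Q (tr false g)) / 2.
  have m0 : 0 < m by rewrite divr_gt0// lt_min !tr_neq.
  have near_far b : \forall h \near g, m <= pair_rho rho Q (tr b h).
    have m2 : 2 * m <= pair_rho rho Q (tr b g).
      by rewrite /m mulrC divfK//; case: b; rewrite ge_min lexx ?orbT.
    have /cvgrPdist_lt /(_ _ m0) := tr_cont b g.
    apply: filterS => h; rewrite ltr_norml => /andP[_]; lra.
  exists [set h | forall b, m <= pair_rho rho Q (tr b h)].
    apply: filterS (filterI (near_far true) (near_far false)).
    by move=> h [h1 h2] [].
  by exists m => // b h /(_ b).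
have m0 : 0 < Num.min e 1 by rewrite lt_min e0 ltr01.
have [Q' [g gQ'] lt_m] := close_Q _ m0.
have [b Qb] : exists b, Q' = tr b g by case: gQ' => ->; [exists true|exists false].
move: lt_m; rewrite Qb lt_min => /andP[lt_e lt_1].
suff Cg : C g by have := far_e b g Cg; rewrite leNgt lt_e.
exists P.1 => //; move: lt_1; rewrite /pair_rho.
have := metric_ge0 rm Q.1 (tr b g).1; have := metric_ge0 rm Q.2 (tr b g).2.
by case: b {Qb lt_e} => /= *; [left|right]; rewrite /=; lra.
Qed.

End PairOrbits.

(** * Recovering the group from the classes of pairs *)

Section Reconstruction.
Variables (G : topologicalGroupType) (X : topologicalType) (act : G -> X -> X).
Variable w : X.
Hypothesis act_action : is_action act.
Hypotheses (F1 : free_at act w) (F2 : effective_on act (~` orbit_of act w)).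

(** A map that fixes [w] and preserves classes fixes every point outside the orbit
    of [w], as [w] has trivial stabiliser; on this orbit it is then given by a
    group element that fixes all points outside it. *)
Lemma pair_symmetry_in_group (f : X -> X) (x z : X) :
  ~ orbit_of act w x -> z <> w -> ~ orbit_of act x z ->
  (forall p q, p <> q -> same_pair act (p, q) (f p, f q)) ->
  exists g, f = act g.
Proof.
move=> wx zw xz f_pair.
have orbit_same a b y : orbit_of act a y -> orbit_of act b y -> orbit_of act a b.
  move=> [g _ <-] [h _ eq_y]; exists (h^-1 * g)%g => //.
  by rewrite (proj2 act_action) -eq_y actK.
have [g0 _ fw] : orbit_of act w (f w).
  apply: contrapT => nfw.
  have wx' : w <> x.
    move=> eq_x; apply: wx; rewrite -eq_x; exists 1%g => //.
    by rewrite (proj1 act_action).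
  have via y : w <> y -> orbit_of act y (f w).
    move=> /f_pair [g [[fw _]|[fw _]]]; first by case: nfw; exists g.
    by exists g.
  by apply: xz; apply: orbit_same (via x wx') (via z (nesym zw)).
pose f' y := act g0^-1%g (f y).
have f'_pair p q : p <> q -> same_pair act (p, q) (f' p, f' q).
  move=> /f_pair pq; apply: same_pair_trans pq _ => //.
  by exists g0^-1%g; left.
have f'w : f' w = w by rewrite /f' -fw actK.
have free_inj g h : act g w = act h w -> g = h.
  move=> eq_gh; have : (h^-1 * g)%g = 1%g.
    by apply: F1; rewrite (proj2 act_action) eq_gh actK.
  by move=> /(congr1 (fun k => h * k)%g); rewrite mulVKg mulg1.
have f'_off y : ~ orbit_of act w y -> f' y = y.
  move=> wy; have wy' : w <> y.
    by move=> eq_y; apply: wy; rewrite -eq_y; exists 1%g => //; rewrite (proj1 act_action).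
  have [g []] := f'_pair w y wy'; rewrite f'w /= => -[wg f'y].
    by rewrite f'y (F1 (esym wg)) (proj1 act_action).
  by case: wy; exists g^-1%g => //; rewrite wg actK.
have f'_on k : f' (act k w) = act k w.
  have step y : ~ orbit_of act w y ->
      exists h, f' (act k w) = act h (act k w) /\ act h y = y.
    move=> wy; have ky : act k w <> y by move=> eq_y; apply: wy; exists k.
    have [h []] := f'_pair _ _ ky; rewrite (f'_off y wy) /= => -[f'k yh].
      by exists h.
    by case: wy; exists (h * k)%g => //; rewrite (proj2 act_action).
  have [h [f'k hx]] := step x wx.
  suff h1 : h = 1%g by rewrite f'k h1 (proj1 act_action).
  apply: F2 => y wy; have [h' [f'k' h'y]] := step y wy.
  suff -> : h = h' by [].
  have : (h * k)%g = (h' * k)%g by apply: free_inj; rewrite !(proj2 act_action) -f'k -f'k'.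
  by move/mulIg.
exists g0; apply/funext => y.
rewrite -[LHS](actKV act_action g0); congr (act g0 _); rewrite -/(f' y).
have [[k _ <-]|wy] := pselect (orbit_of act w y); first exact: f'_on.
exact: f'_off.
Qed.

(** If every [z <> w] were in the orbit of [x], no group element could move [w], so
    [G] would be trivial and [X] reduced to [w] and [x]. *)
Lemma second_pair_point (x : X) : ~ orbit_of act w x ->
  ~ ([set: G] #= `I_1 /\ [set: X] #= `I_2) ->
  exists2 z, z <> w & ~ orbit_of act x z.
Proof.
move=> wx; apply: contra_notP => none.
have inx z : z <> w -> orbit_of act x z.
  by move=> zw; apply: contrapT => nz; apply: none; exists z.
have G1 (g : G) : g = 1%g.
  apply: F1; apply: contrapT => /inx [h _ eq_h]; apply: wx.
  by exists (h^-1 * g)%g => //; rewrite (proj2 act_action) -eq_h actK.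
have wx' : w <> x.
  by move=> eq_x; apply: wx; rewrite -eq_x; exists 1%g => //; rewrite (proj1 act_action).
have X2 z : z = w \/ z = x.
  have [->|zw] := pselect (z = w); [by left|right].
  by have [g _ <-] := inx z zw; rewrite (G1 g) (proj1 act_action).
split; apply/card_set_bijP.
  exists (fun=> 0%N); split=> //.
  - by move=> g h _ _ _; rewrite (G1 g) (G1 h).
  - by move=> n /=; rewrite ltnS leqn0 => /eqP ->; exists 1%g.
exists (fun z => if z == w then 0%N else 1%N); split.
- by move=> z _ /=; case: eqP.
- move=> y z _ _; have [->|->] := X2 y; have [->|->] := X2 z; rewrite ?eqxx //;
    by case: eqP => // /esym.
- move=> [_|[_|//]]; first by exists w => //; rewrite eqxx.
  by exists x => //; case: eqP => // /esym.
Qed.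

End Reconstruction.

End Preliminaries.

(** * The theorem *)

Theorem theorem1p1 (R : realType) (G : topologicalGroupType)
    (X : topologicalType) (act : G -> X -> X) (w : X)
    (G_lc : locally_compact [set: G]) (G_polish : polish R G)
    (X_lc : locally_compact [set: X]) (X_polish : polish R X)
    (card_GX : ~ ([set: G] #= `I_1 /\ [set: X] #= `I_2))
    (act_action : is_action act)
    (act_continuous : continuous_action act)
    (act_proper : proper_action act)
    (act_nontransitive : ~ transitive_action act)
    (F1 : free_at act w)
    (F2 : effective_on act (~` orbit_of act w)) :
  exists2 d : X -> X -> R, Metr_c d & Iso d = [set act a | a in [set: G]].
Proof.
have [rho rho_Metr_c rho_act] :=
  invariant_proper_metric w X_lc X_polish act_action act_continuous act_proper.
have [c c_dense] := separable_seq w (proj1 X_polish).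
have [d [d_Metr_c d_pair d_iso]] := pair_class_metric rho_Metr_c c_dense
  (same_pair_refl act_action) (same_pair_sym act_action)
  (same_pair_trans act_action) (same_pair_transport rho_act)
  (same_pair_dist rho_act rho_Metr_c)
  (same_pair_closed rho_Metr_c act_continuous act_proper)
  (same_pair_swap act_action).
exists d => //; apply/seteqP; split=> [f [[g fg gf] f_iso]|_ [a _ <-]]; last first.
  split; first by exists (act a^-1%g) => y; rewrite ?actK ?actKV.
  by move=> y z; symmetry; apply: (d_pair (y, z) (act a y, act a z)); exists a; left.
have [x wx] : exists x, ~ orbit_of act w x.
  apply: contrapT => none; apply: act_nontransitive; exists w.
  apply/seteqP; split=> // y _; apply: contrapT => wy; apply: none; by exists y.
have [z zw xz] := second_pair_point act_action F1 wx card_GX.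
have [a ->] := pair_symmetry_in_group act_action F1 F2 wx zw xz
  (d_iso f g fg gf f_iso).
by exists a.
Qed.
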